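(* Let $\alpha,\beta>-1$, $a<0$, and $n\in\mathbb{N}$, $n\ge 1$. Then there exists $\Gamma>-1$ (depending on $\alpha,\beta,a,n$) such that for $\gamma\in(\Gamma,\infty)$ every negative zero $x_{n,j}(\alpha,\beta,\gamma;a)$, $j=1,\dots,n$, of $P_n^{(\alpha,\beta,\gamma)}(x;a)$ is a decreasing function of $\gamma$, and every positive zero $x_{n,j}(\alpha,\beta,\gamma;a)$, $j=n+1,\dots,2n$, is an increasing function of $\gamma$.
   Context: Angelesco-Jacobi polynomials: for $a<0$, $\alpha,\beta,\gamma>-1$ and $n\in\mathbb{N}\cup\{0\}$, $P_n^{(\alpha,\beta,\gamma)}(x;a)$ denotes the unique monic polynomial in $x$ of degree $2n$ such that for $k=0,1,\dots,n-1$, $$\int_a^0 x^k P_n^{(\alpha,\beta,\gamma)}(x;a)(1-x)^\alpha(x-a)^\beta|x|^\gamma\,dx=0,\qquad \int_0^1 x^k P_n^{(\alpha,\beta,\gamma)}(x;a)(1-x)^\alpha(x-a)^\beta x^\gamma\,dx=0.$$ All its zeros are real and simple; they are denoted in increasing order by $x_{n,1}(\alpha,\beta,\gamma;a)<\cdots<x_{n,2n}(\alpha,\beta,\gamma;a)$. Exactly $n$ of them (indices $1,\dots,n$) lie in $(a,0)$ and exactly $n$ (indices $n+1,\dots,2n$) lie in $(0,1)$. *)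

(* Defs.v *)
From HB Require Import structures.
From mathcomp Require Import all_boot all_order all_algebra.
From mathcomp Require Import all_classical all_reals all_analysis.
From mathcomp Require Import polyrcf.

Set Implicit Arguments.
Unset Strict Implicit.
Unset Printing Implicit Defensive.

Import Order.TTheory GRing.Theory Num.Theory.
Import numFieldNormedType.Exports.

Local Open Scope classical_set_scope.
Local Open Scope ring_scope.

(* On the open intervals ]a, 0[ and ]0, 1[ the bases of all the powers below
   are positive, so that the values of powR at nonpositive bases play no role;
   the omitted endpoints have Lebesgue measure zero. *)
Definition is_angelesco_jacobi (R : realType) (alpha beta gamma a : R)
    (n : nat) (p : {poly R}) : Prop :=
  [/\ p \is monic,
      size p = (2 * n).+1 &
      forall k : nat, (k < n)%N ->
        \int[lebesgue_measure]_(x in `]a, 0[)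
           (x ^+ k * p.[x] * (1 - x) `^ alpha * (x - a) `^ beta
            * `|x| `^ gamma) = 0 /\
        \int[lebesgue_measure]_(x in `]0, 1[)
           (x ^+ k * p.[x] * (1 - x) `^ alpha * (x - a) `^ beta
            * x `^ gamma) = 0].

(* For a < 0 and alpha, beta, gamma > -1 exactly one polynomial satisfies
   is_angelesco_jacobi, hence the default value 0 is not taken. *)
Definition angelesco_jacobi (R : realType) (alpha beta gamma a : R)
    (n : nat) : {poly R} :=
  xget 0 [set p | is_angelesco_jacobi alpha beta gamma a n p].

(* rootsR lists the distinct real roots in increasing order. The index j
   starts from 1; as the zeros are real and simple, the list has length 2n. *)
Definition angelesco_jacobi_zero (R : realType) (alpha beta gamma a : R)
    (n j : nat) : R :=
  (rootsR (angelesco_jacobi alpha beta gamma a n))`_j.-1.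

(* Main.v *)
Require Import Defs.
From HB Require Import structures.
From mathcomp Require Import all_boot all_order all_algebra.
From mathcomp Require Import all_classical all_reals all_analysis.
From mathcomp Require Import polyrcf.
From mathcomp Require Import measurable_realfun.
From mathcomp Require Import ring lra zify.

Set Implicit Arguments.
Unset Strict Implicit.
Unset Printing Implicit Defensive.

Import Order.TTheory GRing.Theory Num.Theory.
Import numFieldNormedType.Exports.

Local Open Scope classical_set_scope.
Local Open Scope ring_scope.

(* In the variable u = |x| the zeros of either interval are the zeros of an
   ordinary orthogonal polynomial, for the Jacobi weight times
   C(u) u^gamma, where C(u) = prod_j (u + xi_j) carries the zeros xi_j of the
   other interval. As gamma grows, squares of polynomials of bounded degree
   concentrate near the far endpoints |a| and 1. For q of degree n - 1
   vanishing at the zeros of one weight above index k and at those of another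
   weight below k, Gauss quadrature signs the integrals of (u - zero_k) q^2
   for both weights. Comparing the two integrals shows, thanks to the
   concentration, that the k-th zero moves by at most
   eps (|delta gamma| + sum_j |delta xi_j|) with eps small for gamma large;
   used on both intervals, this bounds all displacements by a small multiple
   of delta gamma. Then the factor u^(delta gamma) dominates the change of C,
   the ratio of the two weights is strictly increasing in u, and the same
   comparison (Markov's theorem) makes every |zero| strictly increase. *)

(** * Integration against the Jacobi weight *)

(** Markov's theorem asks for a weight whose dependence on gamma is known, but the factor C(u) moves
    with the zeros of the other interval, and growing xi_j work against the growth of u^gamma.
    Displacements must therefore be bounded before any monotonicity is available. This is done with
    finite differences, so neither differentiability nor continuity of the zeros in gamma is used.
    The two weights are scaled to agree at a zero v; their difference is then O(|u - v|), and the
    factor u - v of the test leaves a second-order term, which concentration makes small in mean.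
    Nothing keeps u away from 0, so comparing the weights costs a factor u^(-2): hence the exponent
    gamma - 2 in the concentration estimate, and thresholds of at least 2. Only steps of gamma of
    length at most 1 are compared; longer ones are chained. The Jacobi factor, possibly singular at
    an endpoint, is hidden in an abstract positive functional tested on bounded functions, so one
    argument serves both intervals. *)

Lemma integrable_bounded_primitive (R : realType) (f F : R -> R) (lo hi M : R) :
  lo < hi ->
  {in `]lo, hi[, forall x, 0 <= f x} ->
  {in `]lo, hi[, continuous f} ->
  {in `]lo, hi[, forall x : R, is_derive x 1 F (f x)} ->
  {in `]lo, hi[, forall x, `|F x| <= M} ->
  (@lebesgue_measure R).-integrable `]lo, hi[ (EFin \o f).
Proof.
move=> lohi f0 cf dF FM.
(* [f] may blow up at the endpoints, so the fundamental theorem is applied on closed subintervals,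
   where it gives at most 2M, and monotone convergence does the rest. With [n.+3] the margin is at
   most a third of the length, so every [G n] is nondegenerate. *)
pose e (n : nat) : R := (hi - lo) / n.+3%:R.
have h0 : 0 < hi - lo by rewrite subr_gt0.
have e0 n : 0 < e n by rewrite divr_gt0.
have eS n : lo + e n < hi - e n.
  rewrite ltrBrDr -addrA -ltrBrDl /e -mulrDl ltr_pdivrMr//.
  rewrite -[in ltRHS]natr1 -[in ltRHS](natr1 n.+1) -[in ltRHS](natr1 n).
  have : 0 <= n%:R * (hi - lo) by rewrite mulr_ge0 // ltW.
  lra.
pose G n := `[lo + e n, hi - e n]%classic.
have GS n : G n `<=` `]lo, hi[%classic.
  by move=> x; rewrite /G /= !in_itv/= => /andP[]; have := e0 n; lra.
have UG : \bigcup_n G n = `]lo, hi[%classic.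
  apply/seteqP; split; first by apply: bigcup_sub => n _; exact: GS.
  move=> x /=; rewrite in_itv/= => /andP[lx xh].
  pose d := Num.min (x - lo) (hi - x).
  have d0 : 0 < d by rewrite lt_min !subr_gt0 lx xh.
  exists (Num.truncn ((hi - lo) / d)) => //; rewrite /G /= in_itv/=.
  have : e (Num.truncn ((hi - lo) / d)) <= d.
    rewrite ler_pdivrMr // mulrC -ler_pdivrMr //.
    apply: (le_trans (ltW (truncnS_gt _))).
    by rewrite ler_nat; do 2 apply: leqW.
  rewrite le_min => /andP[]; lra.
have mG n : measurable (G n) by exact: measurable_itv.
have mfoo : measurable_fun `]lo, hi[%classic f.
  apply: open_continuous_measurable_fun => //.
  by move=> x; rewrite inE => xlh; exact: cf.
apply/integrableP; split; first exact/measurable_EFinP.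
under eq_integral.
  move=> x; rewrite inE => xlh; rewrite /= ger0_norm; last exact: f0.
over.
have cvgI : (\int[lebesgue_measure]_(x in G n) (f x)%:E)%E @[n --> \oo] -->
    (\int[lebesgue_measure]_(x in `]lo, hi[%classic) (f x)%:E)%E.
  rewrite -UG; apply: ge0_nondecreasing_set_cvg_integral => //.
  - apply/nondecreasing_seqP => n; rewrite subsetEset => x.
    rewrite /G /= !in_itv/= => /andP[].
    suff : e n.+1 <= e n by lra.
    by rewrite ler_pM2l // lef_pV2 ?posrE // ler_nat.
  - move=> n; apply/measurable_EFinP; apply: measurable_funS mfoo.
      exact: measurable_itv.
    exact: GS.
  - by move=> n x /GS xlh; rewrite lee_fin; exact: f0.
have Fcont x : x \in `]lo, hi[ -> {for x, continuous F}.
  by move=> /dF dFx; apply/differentiable_continuous/derivable1_diffP.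
have bnd n : (\int[lebesgue_measure]_(x in G n) (f x)%:E <= (2 * M)%:E)%E.
  have ein : lo + e n \in `]lo, hi[.
    by rewrite in_itv/=; have := e0 n; have := eS n; lra.
  have ein' : hi - e n \in `]lo, hi[.
    by rewrite in_itv/=; have := e0 n; have := eS n; lra.
  rewrite (@continuous_FTC2 _ f F) ?eS //.
  - rewrite -EFinB lee_fin.
    have := FM _ ein; have := FM _ ein'; rewrite !ler_norml; lra.
  - apply: continuous_in_subspaceT => x; rewrite inE => /GS; exact: cf.
  - split.
    + move=> x xG; have /dF[//] : x \in `]lo, hi[.
      by apply: GS; rewrite /G /=; exact: subset_itv_oo_cc xG.
    + by apply: cvg_at_right_filter; exact: Fcont.
    + by apply: cvg_at_left_filter; exact: Fcont.
  - move=> x xG; have /dF dx : x \in `]lo, hi[.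
      by apply: GS; rewrite /G /=; exact: subset_itv_oo_cc xG.
    by rewrite derive1E derive_val.
apply: (@le_lt_trans _ _ (2 * M)%:E); last exact: ltry.
rewrite -(cvg_lim (@ereal_hausdorff R) cvgI).
by apply: lime_le; [apply/cvg_ex; eexists; exact: cvgI | near=> n; exact: bnd].
Unshelve. all: by end_near. Qed.

Lemma powR_itv_bounded (R : realType) (c d r : R) : 0 < c ->
  exists M : R, forall y, c <= y <= d -> y `^ r <= M.
Proof.
(* A power is monotone, so it is bounded by its value at one end, which end depending on the sign of
   [r]; the sum covers both cases. *)
move=> c0; exists (c `^ r + d `^ r) => y /andP[cy yd].
have y0 : 0 < y by exact: lt_le_trans cy.
have d0 : 0 < d by exact: lt_le_trans yd.
have [r0|r0] := leP 0 r.
  apply: (@le_trans _ _ (d `^ r)); last by rewrite lerDr powR_ge0.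
  by apply: ge0_ler_powR => //; rewrite nnegrE ltW.
apply: (@le_trans _ _ (c `^ r)); last by rewrite lerDl powR_ge0.
rewrite -[r]opprK !(powRN _ (- r)) lef_pV2 ?posrE ?powR_gt0 //.
by apply: ge0_ler_powR => //; rewrite ?nnegrE ?oppr_ge0 ltW.
Qed.

Lemma integrable_powR_left (R : realType) (c d r : R) : c < d -> -1 < r ->
  (@lebesgue_measure R).-integrable `]c, d[ (EFin \o (fun x => (x - c) `^ r)).
Proof.
move=> cd r1; have r10 : r + 1 != 0 by rewrite gt_eqF // -ltrBlDr sub0r.
(* Since r + 1 > 0, this primitive stays bounded up to the singular endpoint. *)
pose F x := (r + 1)^-1 * (x - c) `^ (r + 1).
have dF : {in `]c, d[, forall x : R, is_derive x 1 F ((x - c) `^ r)}.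
  move=> x; rewrite in_itv/= => /andP[cx _].
  have xc : 0 < x - c by rewrite subr_gt0.
  have H := is_derive1_powR (r + 1) xc.
  have G : is_derive x 1 (fun y : R => y - c) 1.
    by apply: is_derive_eq; rewrite subr0.
  have K : is_derive x 1 (fun y : R => (y - c) `^ (r + 1))
     ((r + 1) * (x - c) `^ (r + 1 - 1) * 1).
    exact: (@is_derive1_comp _ _ (fun y : R => y - c) _ _ _ H G).
  apply: is_derive_eq.
  rewrite mulr1 addrK /GRing.scale/= mulrA mulVf ?mul1r//.
apply: (@integrable_bounded_primitive _ _ F _ _
   (`|(r + 1)^-1| * (d - c) `^ (r + 1))) => //.
- by move=> x _; rewrite powR_ge0.
- move=> x; rewrite in_itv/= => /andP[cx _].
  have xc : 0 < x - c by rewrite subr_gt0.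
  have H := is_derive1_powR r xc.
  have G : is_derive x 1 (fun y : R => y - c) 1.
    by apply: is_derive_eq; rewrite subr0.
  have K : is_derive x 1 (fun y : R => (y - c) `^ r)
     (r * (x - c) `^ (r - 1) * 1).
    exact: (@is_derive1_comp _ _ (fun y : R => y - c) _ _ _ H G).
  by apply/differentiable_continuous/derivable1_diffP.
- move=> x; rewrite in_itv/= => /andP[cx xd].
  rewrite normrM ler_wpM2l // norm_powR ?subr_ge0 ?(ltW cx) //.
  rewrite ger0_norm ?subr_ge0 ?(ltW cx) //.
  apply: ge0_ler_powR; rewrite ?nnegrE ?subr_ge0 ?(ltW cx) //; last first.
  - by rewrite lerB // ltW.
  - by rewrite ltW // (lt_trans cx).
  - by rewrite -lerBlDr sub0r ltW.
Qed.

Lemma integrable_powR_right (R : realType) (c d r : R) : c < d -> -1 < r ->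
  (@lebesgue_measure R).-integrable `]c, d[ (EFin \o (fun x => (d - x) `^ r)).
Proof.
move=> cd r1; have r10 : r + 1 != 0 by rewrite gt_eqF // -ltrBlDr sub0r.
pose F x := - ((r + 1)^-1) * (d - x) `^ (r + 1).
have dF : {in `]c, d[, forall x : R, is_derive x 1 F ((d - x) `^ r)}.
  move=> x; rewrite in_itv/= => /andP[_ xd].
  have xc : 0 < d - x by rewrite subr_gt0.
  have H := is_derive1_powR (r + 1) xc.
  have G : is_derive x 1 (fun y : R => d - y) (- 1).
    by apply: is_derive_eq; rewrite add0r mul1r.
  have K : is_derive x 1 (fun y : R => (d - y) `^ (r + 1))
     ((r + 1) * (d - x) `^ (r + 1 - 1) * -1).
    exact: (@is_derive1_comp _ _ (fun y : R => d - y) _ _ _ H G).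
  apply: is_derive_eq.
  rewrite addrK /GRing.scale/= mulrN1 mulrNN mulrA mulVf ?mul1r//.
apply: (@integrable_bounded_primitive _ _ F _ _
   (`|- ((r + 1)^-1)| * (d - c) `^ (r + 1))) => //.
- by move=> x _; rewrite powR_ge0.
- move=> x; rewrite in_itv/= => /andP[_ xd].
  have xc : 0 < d - x by rewrite subr_gt0.
  have H := is_derive1_powR r xc.
  have G : is_derive x 1 (fun y : R => d - y) (- 1).
    by apply: is_derive_eq; rewrite add0r mul1r.
  have K : is_derive x 1 (fun y : R => (d - y) `^ r)
     (r * (d - x) `^ (r - 1) * -1).
    exact: (@is_derive1_comp _ _ (fun y : R => d - y) _ _ _ H G).
  by apply/differentiable_continuous/derivable1_diffP.
- move=> x; rewrite in_itv/= => /andP[cx xd].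
  rewrite normrM ler_wpM2l // norm_powR ?subr_ge0 ?(ltW xd) //.
  rewrite ger0_norm ?subr_ge0 ?(ltW xd) //.
  apply: ge0_ler_powR; rewrite ?nnegrE ?subr_ge0 ?(ltW xd) //; last first.
  - by rewrite lerB // ltW.
  - by rewrite ltW // (lt_trans cx).
  - by rewrite -lerBlDr sub0r ltW.
Qed.

Definition jacobi_weight (R : realType) (alpha beta a x : R) : R :=
  (1 - x) `^ alpha * (x - a) `^ beta.

(** On ]a, 0[ the base 1 - x stays in [1, 1 - a], so only the power of x - a can be singular, and
    only at a. The positive interval is symmetric, with the singularity at 1. *)
Lemma integrable_jacobi_weight_neg (R : realType) (alpha beta a : R) :
  -1 < beta -> a < 0 ->
  (@lebesgue_measure R).-integrable `]a, 0[ (EFin \o jacobi_weight alpha beta a).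
Proof.
move=> b1 a0.
have [M HM] := @powR_itv_bounded R 1 (1 - a) alpha ltr01.
pose h (x : R) : R := (1 - x) `^ alpha; pose g (x : R) : R := (x - a) `^ beta.
suff : (@lebesgue_measure R).-integrable `]a, 0[ ((EFin \o h) \* (EFin \o g))%E.
  by apply: eq_integrable => // x _; rewrite /= -EFinM.
apply: integrableMr; last exact: integrable_powR_left.
- exact: measurable_itv.
- apply: (@measurableT_comp _ _ _ _ _ _ (fun y : R => y `^ alpha) _
    (fun x : R => 1 - x)); first exact: measurable_powR.
  exact: measurable_funB.
- exists M; split; first exact: num_real.
  move=> N MN x; rewrite /= in_itv/= => /andP[ax x0].
  rewrite ger0_norm ?powR_ge0 //; apply: (le_trans _ (ltW MN)).
  by apply: HM; rewrite lerBrDr gerDl (ltW x0) /= lerD2l lerN2 ltW.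
Qed.

Lemma integrable_jacobi_weight_pos (R : realType) (alpha beta a : R) :
  -1 < alpha -> a < 0 ->
  (@lebesgue_measure R).-integrable `]0, 1[ (EFin \o jacobi_weight alpha beta a).
Proof.
move=> b1 a0.
have na0 : 0 < - a by rewrite oppr_gt0.
have [M HM] := @powR_itv_bounded R (- a) (1 - a) beta na0.
pose h (x : R) : R := (1 - x) `^ alpha; pose g (x : R) : R := (x - a) `^ beta.
suff : (@lebesgue_measure R).-integrable `]0, 1[ ((EFin \o h) \* (EFin \o g))%E.
  by apply: eq_integrable => // x _; rewrite /= -EFinM.
apply: integrableMl; first exact: measurable_itv.
- exact: integrable_powR_right.
- apply: (@measurableT_comp _ _ _ _ _ _ (fun y : R => y `^ beta) _
    (fun x : R => x - a)); first exact: measurable_powR.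
  exact: measurable_funB.
- exists M; split; first exact: num_real.
  move=> N MN x; rewrite /= in_itv/= => /andP[ax x0].
  rewrite ger0_norm ?powR_ge0 //; apply: (le_trans _ (ltW MN)).
  by apply: HM; rewrite lerDr (ltW ax) /= lerD2r ltW.
Qed.

(** The test functions: closed under sums and products, and integrable against every integrable
    weight, however singular. *)
Definition admissible (R : realType) (b : R) (f : R -> R) : Prop :=
  measurable_fun `]0, b[ f /\
  exists M : R, {in `]0, b[, forall u, `|f u| <= M}.

(** In [functional_gt0], strict positivity is asked only beyond [c] and off finitely many points:
    this lets a function supported near [b] still have positive integral, as the concentration
    estimate requires. *)
Record positive_functional (R : realType) (b : R) (E : (R -> R) -> R) : Prop :=
  PositiveFunctional {
    functional_dom : 0 < b;
    functionalD : forall f g, admissible b f -> admissible b g ->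
      E (fun u => f u + g u) = E f + E g;
    functionalZ : forall c f, admissible b f ->
      E (fun u => c * f u) = c * E f;
    functional_ge0 : forall f, {in `]0, b[, forall u, 0 <= f u} -> 0 <= E f;
    functional_gt0 : forall f (p : {poly R}) c, admissible b f -> p != 0 ->
      0 <= c < b -> {in `]0, b[, forall u, 0 <= f u} ->
      {in `]c, b[, forall u, ~~ root p u -> 0 < f u} -> 0 < E f }.

(** Reading the test function at |x| turns either interval into ]0, b[ with the origin as common
    endpoint, without a change of variables in the integral. *)
Definition abs_integral (R : realType) (D : set R) (w f : R -> R) : R :=
  \int[lebesgue_measure]_(x in D) (f `|x| * w x).

Lemma abs_integral_positive (R : realType) (l r s b : R) (w : R -> R) :
  s != 0 -> 0 < b ->
  {in `]l, r[, forall x : R, `|x| = s * x /\ 0 < `|x| < b} ->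
  (forall c : R, 0 <= c < b -> exists l' r' : R, [/\ l' < r',
    {subset `]l', r'[ <= `]l, r[} & {in `]l', r'[, forall x : R, c < `|x|}]) ->
  {in `]l, r[, forall x, 0 < w x} ->
  (@lebesgue_measure R).-integrable `]l, r[ (EFin \o w) ->
  positive_functional b (abs_integral `]l, r[ w).
Proof.
move=> s0 b0 habs hsub w0 iw.
have inD (x : R) : `]l, r[%classic x -> `|x| \in `]0, b[.
  by move=> /habs[_]; rewrite in_itv.
have ifw f : admissible b f ->
    (@lebesgue_measure R).-integrable `]l, r[ (EFin \o (fun x => f `|x| * w x)).
  move=> [mf [M HM]].
  pose fa : R -> R := f \o (fun x : R => `|x|).
  suff : (@lebesgue_measure R).-integrable `]l, r[
      ((EFin \o fa) \* (EFin \o w))%E.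
    by apply: eq_integrable => // x _; rewrite /= -EFinM.
  apply: integrableMr => //.
  - apply: measurable_comp mf _ => //; first by move=> _ [x xD <-]; exact: inD.
    exact: normr_measurable.
  - exists M; split; first exact: num_real.
    by move=> N MN x /inD xb; apply: (le_trans _ (ltW MN)); exact: HM.
split=> //.
- move=> f g af ag; rewrite /abs_integral -RintegralD //; [|exact: ifw|exact: ifw].
  by apply: eq_Rintegral => x _; rewrite mulrDl.
- move=> c f af; rewrite /abs_integral -RintegralZl //; last exact: ifw.
  by apply: eq_Rintegral => x _; rewrite mulrA.
- move=> f f0; apply: Rintegral_ge0 => x xD.
  by rewrite mulr_ge0 ?f0 ?inD // ltW // w0.
move=> f p c af p0 cb f0 fp; have [l' [r' [lr' sub' cx]]] := hsub c cb.
have iF := ifw f af.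
have F0 x : `]l, r[%classic x -> 0 <= f `|x| * w x.
  by move=> xD; rewrite mulr_ge0 ?f0 ?inD // ltW // w0.
rewrite lt_neqAle Rintegral_ge0 // andbT; apply/eqP => /esym I0.
(* Strict positivity by contradiction: a vanishing integral makes the integrand zero almost
   everywhere, so ]l', r'[ is covered by a null set and finitely many roots, although its length is
   positive. *)
have : (\int[lebesgue_measure]_(x in `]l, r[) `|(f `|x| * w x)%:E| = 0)%E.
  under eq_integral.
    move=> x; rewrite inE => xD; rewrite gee0_abs ?lee_fin; last exact: F0.
  over.
  rewrite -[LHS]fineK; first by congr (_%:E); exact: I0.
  exact: integrable_fin_num iF.
move=> /(ae_eq_integral_abs _ _) [//||N [mN N0 DN]].
  by case/integrableP: iF.
(* As |x| = s x on the interval, the points x for which |x| is a root of [p] are roots of [q], hence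
   finite in number. *)
pose q := p \Po (s *: 'X).
have q0 : q != 0.
  rewrite -size_poly_eq0 size_comp_poly2 ?size_poly_eq0 //.
  by rewrite size_scale // size_polyX.
have rq : lebesgue_measure [set` rootsR q] = 0%E.
  by apply: countable_lebesgue_measure0; apply: finite_set_countable; exact: finite_seq.
have mrq : measurable ([set` rootsR q] : set R).
  apply: countable_measurable; first by move=> t; exact: measurable_set1.
  by apply: finite_set_countable; exact: finite_seq.
have : (lebesgue_measure (`]l', r'[%classic : set R) <= 0)%E.
  rewrite -[leRHS]add0e -[in X in (_ <= X + _)%E]N0 -rq.
  apply: (@le_trans _ _ (lebesgue_measure (N `|` [set` rootsR q]))); last first.
    exact: measureU2.
  apply: le_measure; rewrite ?inE //.
    exact: measurableU.
  move=> x xD'; have xD : x \in `]l, r[ by exact: sub'.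
  have [rx|nrx] := boolP (root p `|x|).
    right; rewrite /= -(roots_on_rootsR q0) in_itv /=.
    by rewrite /root /q horner_comp !hornerE -(habs _ xD).1.
  left; apply: DN => /= /(_ xD) => -[] /eqP.
  rewrite gt_eqF // mulr_gt0 ?w0 //; apply: fp => //; rewrite in_itv/= cx //.
  by case: (habs x xD) => _ /andP[].
rewrite lebesgue_measure_itv /= lte_fin lr' -EFinB lee_fin subr_le0.
by rewrite leNgt lr'.
Qed.

(** * Gauss quadrature *)

Definition nodal (R : realFieldType) (n : nat) (x : 'I_n -> R) : {poly R} :=
  \prod_(i < n) ('X - (x i)%:P).

Definition orthogonal_below (R : realFieldType) (L : {poly R} -> R) (n : nat)
    (p : {poly R}) : Prop :=
  forall g : {poly R}, (size g <= n)%N -> L (p * g) = 0.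

Lemma size_nodal (R : realFieldType) (n : nat) (x : 'I_n -> R) :
  size (nodal x) = n.+1.
Proof.
by rewrite /nodal size_prod_XsubC /index_enum -enumT size_enum_ord.
Qed.

Lemma monic_nodal (R : realFieldType) (n : nat) (x : 'I_n -> R) :
  nodal x \is monic.
Proof. exact: monic_prod_XsubC. Qed.

Lemma horner_nodal (R : realFieldType) (n : nat) (x : 'I_n -> R) u :
  (nodal x).[u] = \prod_(i < n) (u - x i).
Proof. by rewrite horner_prod; apply: eq_bigr => i _; rewrite !hornerE. Qed.

Lemma nodal_dvdp (R : realFieldType) (n : nat) (x : 'I_n -> R) (f : {poly R}) :
  injective x -> (forall i, f.[x i] = 0) -> nodal x %| f.
Proof.
move=> xi fx; rewrite /nodal -(big_map x xpredT (fun r => 'X - r%:P)).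
apply: uniq_roots_dvdp.
  by apply/allP => _ /mapP[i _ ->]; rewrite rootE fx.
rewrite uniq_rootsE map_inj_uniq //; exact: index_enum_uniq.
Qed.

Lemma size_prod_XsubC_cond (R : realFieldType) (n : nat) (x : 'I_n -> R)
    (P : pred 'I_n) :
  size (\prod_(i < n | P i) ('X - (x i)%:P)) = #|P|.+1.
Proof. by rewrite -big_filter size_prod_XsubC cardE /enum_mem /index_enum; congr (size _).+1; exact: eq_filter. Qed.

(* Gauss quadrature, with the Christoffel numbers expressed as integrals of
   squares so that their signs are visible. *)
Lemma gauss_quadrature (R : realFieldType) (L : {scalar {poly R}}) (n : nat)
    (x : 'I_n -> R) (f : {poly R}) :
  let l i := \prod_(j < n | j != i) ('X - (x j)%:P) in
  injective x -> orthogonal_below L n (nodal x) -> (size f <= 2 * n)%N ->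
  L f = \sum_(i < n) f.[x i] / (l i).[x i] ^+ 2 * L (l i ^+ 2).
Proof.
move=> l xi orth sf.
have lx i j : j != i -> (l i).[x j] = 0.
  by move=> ji; rewrite /l (bigD1 j) //= !hornerE subrr mul0r.
have lxi i : (l i).[x i] != 0.
  rewrite /l horner_prod; apply/prodf_neq0 => j ji.
  by rewrite !hornerE subr_eq0 (inj_eq xi) eq_sym.
have sl i : size (l i) = n.
  rewrite /l size_prod_XsubC_cond cardC1 card_ord prednK //.
  exact: leq_ltn_trans (ltn_ord i).
(* [h] interpolates [f] at the nodes by squares of degree 2n - 2. Then f - h is a multiple of the
   nodal polynomial with a cofactor of degree below n, which orthogonality kills. *)
pose h := \sum_(i < n) (f.[x i] / (l i).[x i] ^+ 2) *: (l i ^+ 2).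
have hx j : (f - h).[x j] = 0.
  rewrite hornerD hornerN /h horner_sum (bigD1 j) //= big1 => [|i ij].
    by rewrite hornerZ horner_exp addr0 divfK ?subrr // expf_neq0.
  by rewrite hornerZ horner_exp (lx i j) ?expr0n ?mulr0 // eq_sym.
have /dvdpP[g fhg] := nodal_dvdp xi hx.
have sg : (size g <= n)%N.
  have [->|g0] := eqVneq g 0; first by rewrite size_poly0.
  have : (size (f - h)%R <= 2 * n)%N.
    apply: (leq_trans (size_polyD _ _)); rewrite geq_max sf size_polyN /=.
    apply: (leq_trans (size_sum _ _ _)); apply/bigmax_leqP => i _.
    apply: (leq_trans (size_scale_leq _ _)).
    apply: (leq_trans (size_poly_exp_leq _ _)); rewrite sl.
    by have := ltn_ord i; lia.
  rewrite fhg size_Mmonic ?monic_nodal // size_nodal.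
  by rewrite addnS /= mul2n -addnn leq_add2r.
have Lfh : L (f - h) = 0 by rewrite fhg mulrC orth.
have -> : L f = L h by apply/eqP; rewrite -subr_eq0 -linearB Lfh.
by rewrite /h linear_sum; apply: eq_bigr => i _; rewrite linearZ.
Qed.

Lemma quadrature_le0 (R : realFieldType) (L : {scalar {poly R}}) (n : nat)
    (x : 'I_n -> R) (f : {poly R}) :
  injective x -> orthogonal_below L n (nodal x) ->
  (forall p : {poly R}, 0 <= L (p ^+ 2)) -> (size f <= 2 * n)%N ->
  (forall i, f.[x i] <= 0) -> L f <= 0.
Proof.
move=> xi orth L0 sf fx; rewrite (gauss_quadrature xi orth sf).
apply: sumr_le0 => i _; apply: mulr_le0_ge0 => //.
by rewrite mulr_le0_ge0 // invr_ge0 sqr_ge0.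
Qed.

Lemma quadrature_ge0 (R : realFieldType) (L : {scalar {poly R}}) (n : nat)
    (x : 'I_n -> R) (f : {poly R}) :
  injective x -> orthogonal_below L n (nodal x) ->
  (forall p : {poly R}, 0 <= L (p ^+ 2)) -> (size f <= 2 * n)%N ->
  (forall i, 0 <= f.[x i]) -> 0 <= L f.
Proof.
move=> xi orth L0 sf fx; rewrite -oppr_le0 -linearN.
apply: (quadrature_le0 xi) => // [|i]; first by rewrite size_polyN.
by rewrite hornerN oppr_le0.
Qed.

(* The polynomial of degree n - 1 vanishing at the zeros of one family above k
   and at the zeros of the other one below k: it lies both in the spectral
   subspace up to x k and in that from y k on. *)
Definition interlacing_test (R : realFieldType) (n : nat) (x y : 'I_n -> R)
    (k : 'I_n) : {poly R} :=
  \prod_(i < n | (k < i)%N) ('X - (x i)%:P)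
  * \prod_(i < n | (i < k)%N) ('X - (y i)%:P).

Lemma size_interlacing_test (R : realFieldType) (n : nat) (x y : 'I_n -> R) k :
  size (interlacing_test x y k) = n.
Proof.
rewrite /interlacing_test size_Mmonic ?monic_prod_XsubC //; last first.
  by rewrite -size_poly_gt0 size_prod_XsubC_cond.
rewrite !size_prod_XsubC_cond addSn /= addnS -[in RHS](card_ord n).
rewrite -(cardC (fun i : 'I_n => (i < k)%N)) addnC.
have -> : #|predC (fun i : 'I_n => (i < k)%N)| = #|fun i : 'I_n => (k < i)%N|.+1.
  rewrite (cardD1 k) inE /= ltnn add1n; congr _.+1.
  by apply: eq_card => i; rewrite !inE -leqNgt [in RHS]unfold_in /= ltn_neqAle eq_sym.
by rewrite addnS.
Qed.

Lemma interlacing_test_neq0 (R : realFieldType) (n : nat) (x y : 'I_n -> R) k :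
  interlacing_test x y k != 0.
Proof. by rewrite -size_poly_gt0 size_interlacing_test (leq_ltn_trans _ (ltn_ord k)). Qed.

Lemma homo_ord_inj (R : realFieldType) (n : nat) (x : 'I_n -> R) :
  {homo x : i j / (i < j)%N >-> i < j} -> injective x.
Proof.
move=> xh i j xij.
by case: (ltngtP i j) => [/xh|/xh|/val_inj //]; rewrite xij ltxx.
Qed.

Lemma size_test_square (R : realFieldType) (n : nat) (x y : 'I_n -> R)
    (c : R) (k : 'I_n) :
  (size (('X - c%:P) * interlacing_test x y k ^+ 2)%R <= 2 * n)%N.
Proof.
apply: (leq_trans (size_polyMleq _ _)); rewrite size_XsubC.
have := size_poly_exp_leq (interlacing_test x y k) 2.
have := leq_ltn_trans (leq0n _) (ltn_ord k).
rewrite size_interlacing_test; move: (size (polyseq (_ ^+ 2))) => m; clear; lia.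
Qed.

(** At the nodes above [k] the test polynomial vanishes, and at the others u - x_k is nonpositive.
    The degree is at most 2n - 1, where quadrature is still exact, so signs at the nodes decide the
    sign of the integral. The next lemma is the mirror image. *)
Lemma interlacing_test_le0 (R : realFieldType) (L : {scalar {poly R}}) (n : nat)
    (x y : 'I_n -> R) (k : 'I_n) :
  {homo x : i j / (i < j)%N >-> i < j} -> orthogonal_below L n (nodal x) ->
  (forall p : {poly R}, 0 <= L (p ^+ 2)) ->
  L (('X - (x k)%:P) * interlacing_test x y k ^+ 2) <= 0.
Proof.
move=> xh orth L0; apply: (quadrature_le0 (homo_ord_inj xh) orth L0).
  exact: size_test_square.
move=> i; rewrite hornerM hornerXsubC horner_exp /interlacing_test hornerM exprMn !horner_prod.
have [ki|ik] := ltnP k i.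
  by rewrite (bigD1 i) //= hornerXsubC subrr mul0r expr0n /= mul0r mulr0.
apply: mulr_le0_ge0; [rewrite subr_le0 | by rewrite mulr_ge0 ?sqr_ge0].
by move: ik; rewrite leq_eqVlt => /predU1P[/val_inj->//|/xh/ltW].
Qed.

Lemma interlacing_test_ge0 (R : realFieldType) (L : {scalar {poly R}}) (n : nat)
    (x y : 'I_n -> R) (k : 'I_n) :
  {homo y : i j / (i < j)%N >-> i < j} -> orthogonal_below L n (nodal y) ->
  (forall p : {poly R}, 0 <= L (p ^+ 2)) ->
  0 <= L (('X - (y k)%:P) * interlacing_test x y k ^+ 2).
Proof.
move=> yh orth L0; apply: (quadrature_ge0 (homo_ord_inj yh) orth L0).
  exact: size_test_square.
move=> i; rewrite hornerM hornerXsubC horner_exp /interlacing_test hornerM exprMn !horner_prod.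
have [ik|ki] := ltnP i k.
  by rewrite [X in _ * (_ * X ^+ 2)](bigD1 i) //= hornerXsubC subrr mul0r expr0n /= !mulr0.
apply: mulr_ge0; [rewrite subr_ge0 | by rewrite mulr_ge0 ?sqr_ge0].
by move: ki; rewrite leq_eqVlt => /predU1P[/val_inj->//|/yh/ltW].
Qed.

(** * Positive functionals and sign changes *)

Lemma admissibleM (R : realType) (b : R) (f g : R -> R) :
  admissible b f -> admissible b g -> admissible b (fun u => f u * g u).
Proof.
move=> [mf [M HM]] [mg [N HN]]; split; first exact: measurable_funM.
exists (M * N) => u ub; rewrite normrM.
by apply: ler_pM => //; [exact: HM|exact: HN].
Qed.

Lemma admissibleD (R : realType) (b : R) (f g : R -> R) :
  admissible b f -> admissible b g -> admissible b (fun u => f u + g u).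
Proof.
move=> [mf [M HM]] [mg [N HN]]; split; first exact: measurable_funD.
exists (M + N) => u ub; apply: (le_trans (ler_normD _ _)).
by apply: lerD; [exact: HM|exact: HN].
Qed.

Lemma admissible_cst (R : realType) (b c : R) : admissible b (fun=> c).
Proof. by split; [exact: measurable_cst | exists `|c|]. Qed.

Lemma admissible_id (R : realType) (b : R) : admissible b id.
Proof.
split; first exact: measurable_id.
by exists b => u; rewrite in_itv/= => /andP[u0 /ltW]; rewrite ger0_norm // ltW.
Qed.

Lemma admissible_horner (R : realType) (b : R) (p : {poly R}) :
  admissible b (fun u => p.[u]).
Proof.
elim/poly_ind: p => [|p c IH].
  by under eq_fun do rewrite horner0; exact: admissible_cst.
under eq_fun do rewrite hornerMXaddC.
apply: admissibleD; last exact: admissible_cst.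
by apply: admissibleM => //; exact: admissible_id.
Qed.

Lemma admissible_powR (R : realType) (b r : R) : 0 <= r ->
  admissible b (fun u => u `^ r).
Proof.
move=> r0; split.
  by apply: measurable_funS (measurable_powR r).
exists (b `^ r) => u; rewrite in_itv/= => /andP[u0 ub].
rewrite norm_powR ?(ltW u0) // gtr0_norm //.
by apply: ge0_ler_powR => //; rewrite ?nnegrE ltW // (lt_trans u0).
Qed.

Section PositiveFunctional.
Variables (R : realType) (b : R) (E : (R -> R) -> R).
Hypothesis EP : positive_functional b E.

Lemma functional_le (f g : R -> R) : admissible b f -> admissible b g ->
  {in `]0, b[, forall u, f u <= g u} -> E f <= E g.
Proof.
move=> af ag fg; have aNf : admissible b (fun u => -1 * f u).
  by apply: admissibleM => //; exact: admissible_cst.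
rewrite -subr_ge0 -mulN1r -(functionalZ EP) // -(functionalD EP) //.
by apply: (functional_ge0 EP) => u ub; rewrite mulN1r subr_ge0 fg.
Qed.

Lemma poly_functional (w : R -> R) : admissible b w ->
  exists L : {scalar {poly R}}, forall p, L p = E (fun u => p.[u] * w u).
Proof.
move=> aw; pose L (p : {poly R}) : R := E (fun u => p.[u] * w u).
have apw p : admissible b (fun u => p.[u] * w u).
  by apply: admissibleM => //; exact: admissible_horner.
have linL : linear_for *%R L.
  move=> c p q; rewrite /L -(functionalZ EP) // -(functionalD EP) //; last first.
    by apply: admissibleM => //; exact: admissible_cst.
  congr E; apply/funext => u.
  by rewrite hornerD hornerZ mulrDl mulrA.
pose L' : {scalar {poly R}} := HB.pack L (GRing.isLinear.Build _ _ _ _ _ linL).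
by exists L'.
Qed.

Lemma functional_square_gt0 (w : R -> R) (p : {poly R}) : admissible b w ->
  {in `]0, b[, forall u, 0 < w u} -> p != 0 ->
  0 < E (fun u => p.[u] ^+ 2 * w u).
Proof.
move=> aw w0 p0; apply: (functional_gt0 (c := 0) EP _ p0).
- apply: admissibleM => //; under eq_fun do rewrite -horner_exp.
  exact: admissible_horner.
- by rewrite lexx (functional_dom EP).
- by move=> u ub; rewrite mulr_ge0 ?sqr_ge0 // ltW // w0.
- by move=> u ub ru; rewrite mulr_gt0 ?w0 // exprn_even_gt0.
Qed.

End PositiveFunctional.

(** A square linear system with trivial kernel is solvable. It produces the monic orthogonal
    polynomials below and, from 2n moment conditions, the Angelesco-Jacobi polynomial itself. *)
Lemma solve_functionals (R : fieldType) (n : nat)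
    (l : 'I_n -> {poly R} -> R) (t : 'I_n -> R) :
  (forall i, scalar (l i)) ->
  (forall p : {poly R}, (size p <= n)%N -> (forall i, l i p = 0) -> p = 0) ->
  exists2 p : {poly R}, (size p <= n)%N & forall i, l i p = t i.
Proof.
move=> llin linj.
pose k i : {scalar {poly R}} :=
  HB.pack (l i) (GRing.isLinear.Build _ _ _ _ _ (llin i)).
pose M := \matrix_(j < n, i < n) k i 'X^j.
have lM (v : 'rV_n) i : l i (rVpoly v) = (v *m M) 0 i.
  rewrite -[l i _]/(k i _) [v in LHS]row_sum_delta !linear_sum mxE.
  apply: eq_bigr => j _.
  by rewrite linearZ linearZ /= rVpoly_delta !mxE.
have uM : M \in unitmx.
  rewrite -row_free_unit; apply: inj_row_free => v vM0.
  apply: (can_inj rVpolyK); rewrite linear0; apply: linj; first exact: size_poly.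
  by move=> i; rewrite lM vM0 mxE.
exists (rVpoly (\row_i t i *m invmx M)); first exact: size_poly.
by move=> i; rewrite lM mulmxKV // mxE.
Qed.

(** [s] collects the roots of odd multiplicity in the interval. The induction splits off one linear
    factor at a time, and without roots in the interval the intermediate value theorem gives a
    constant sign. *)
Lemma sign_change_roots (R : rcfType) (lo hi : R) (p : {poly R}) : p != 0 ->
  exists s : seq R, [/\ uniq s, {subset s <= `]lo, hi[},
    {subset s <= root p} &
    {in `]lo, hi[, forall u, 0 <= (p * \prod_(r <- s) ('X - r%:P)).[u]} \/
    {in `]lo, hi[, forall u, (p * \prod_(r <- s) ('X - r%:P)).[u] <= 0}].
Proof.
have [n sp] := ubnP (size p); elim: n => // n IH in p sp * => p0.
have [|/existsNP[r]] := pselect (forall r, r \in `]lo, hi[ -> ~~ root p r).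
  move=> nor; exists [::]; split => //; rewrite big_nil mulr1.
  have [|/existsNP[u /not_implyP[ulh /negP]]] :=
      pselect ({in `]lo, hi[, forall u, 0 <= p.[u]}); first by left.
  rewrite -ltNge => pu; right => v vlh; rewrite leNgt; apply/negP => pv.
  have [c cuv] : exists2 c, c \in `]lo, hi[ & root p c; last first.
    by apply/negP; exact: nor.
  move: ulh vlh; rewrite !in_itv/= => /andP[lu uh] /andP[lv vh].
  have [uv|/ltW vu] := leP u v.
    have [|c] := @poly_ivtoo _ p u v uv; first by rewrite pmulr_llt0.
    rewrite in_itv/= => /andP[uc cv] rc; exists c => //.
    by rewrite in_itv/= (lt_trans lu) // (lt_trans cv).
  have [|c] := @poly_ivtoo _ p v u vu; first by rewrite pmulr_rlt0.
  rewrite in_itv/= => /andP[uc cv] rc; exists c => //.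
  by rewrite in_itv/= (lt_trans lv) // (lt_trans cv).
move=> /not_implyP[rlh /negP]; rewrite negbK => /factor_theorem[q pq].
have q0 : q != 0 by apply: contraNneq p0 => q0; rewrite pq q0 mul0r.
have [|s [us slh sq sgn]] := IH q _ q0.
  by move: sp; rewrite pq size_Mmonic ?monicXsubC // size_XsubC addn2 /=.
have subp t : t \in s -> root p t.
  by move=> /sq qt; rewrite pq rootM; apply/orP; left.
(* One more factor at [r] switches the parity of its multiplicity: [r] leaves [s] if it was there
   and joins it otherwise. *)
have [rs|rs] := boolP (r \in s).
  exists (rem r s); split.
  - exact: rem_uniq.
  - by move=> t /mem_rem; exact: slh.
  - by move=> t /mem_rem; exact: subp.
  - have -> : p * \prod_(t <- rem r s) ('X - t%:P) = q * \prod_(t <- s) ('X - t%:P).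
      by rewrite (perm_big _ (perm_to_rem rs)) big_cons mulrA -pq.
    exact: sgn.
exists (r :: s); split.
- by rewrite /= rs.
- by move=> t; rewrite inE => /predU1P[->//|/slh].
- move=> t; rewrite inE => /predU1P[->|/subp//].
  by rewrite -topredE /= pq rootM root_XsubC eqxx orbT.
- have E u : (p * \prod_(t <- r :: s) ('X - t%:P)).[u] =
      (u - r) ^+ 2 * (q * \prod_(t <- s) ('X - t%:P)).[u].
    by rewrite big_cons pq !hornerM !hornerXsubC; ring.
  case: sgn => sgn; [left|right] => u ulh; rewrite E.
  + by rewrite mulr_ge0 ?sqr_ge0 // sgn.
  + by rewrite mulr_ge0_le0 ?sqr_ge0 // sgn.
Qed.

(** With fewer than n sign changes, the polynomial vanishing at them would be an allowed test [g],
    yet p g would keep one sign and have a nonzero integral. *)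
Lemma orthogonal_many_roots (R : realType) (b : R) (E : (R -> R) -> R)
    (w : R -> R) (n : nat) (p : {poly R}) :
  positive_functional b E -> admissible b w ->
  {in `]0, b[, forall u, 0 < w u} -> p != 0 ->
  (forall g : {poly R}, (size g <= n)%N -> E (fun u => (p * g).[u] * w u) = 0) ->
  exists s : seq R, [/\ uniq s, {subset s <= `]0, b[}, {subset s <= root p}
    & (n <= size s)%N].
Proof.
move=> EP aw w0 p0 orth.
have [s [us sb sp sgn]] := sign_change_roots 0 b p0.
exists s; split => //; rewrite leqNgt; apply/negP => sn.
pose g := \prod_(r <- s) ('X - r%:P).
have pg0 : p * g != 0 by rewrite mulf_neq0 // monic_neq0 // monic_prod_XsubC.
have sg : (size g <= n)%N by rewrite size_prod_XsubC.
have aE h : admissible b (fun u => h.[u] * w u).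
  by apply: admissibleM => //; exact: admissible_horner.
have [sgn_ge0|sgn_le0] := sgn.
- suff : 0 < E (fun u => (p * g).[u] * w u) by rewrite orth // ltxx.
  apply: (functional_gt0 (c := 0) EP _ pg0) => // [|u ub|u ub ru].
  + by rewrite lexx (functional_dom EP).
  + by rewrite mulr_ge0 ?sgn_ge0 // ltW // w0.
  + by rewrite mulr_gt0 ?w0 // lt_neqAle eq_sym ru sgn_ge0.
- have nsg : (size (- g)%R <= n)%N by rewrite size_polyN.
  suff : 0 < E (fun u => (p * - g).[u] * w u) by rewrite orth // ltxx.
  apply: (functional_gt0 (c := 0) EP _ pg0) => // [|u ub|u ub ru].
  + by rewrite lexx (functional_dom EP).
  + by rewrite mulrN hornerN mulr_ge0 ?oppr_ge0 ?sgn_le0 // ltW // w0.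
  + by rewrite mulrN hornerN mulr_gt0 ?w0 // oppr_gt0 lt_neqAle ru sgn_le0.
Qed.

(** * Concentration at the endpoint *)

Lemma powR_div (R : realType) (v u x : R) : 0 < v -> 0 < u ->
  (v / u) `^ x = v `^ x / u `^ x.
Proof.
move=> v0 u0; rewrite powRM ?invr_ge0 ?(ltW u0) ?(ltW v0) //.
by rewrite -powR_inv1 ?(ltW u0) // powRAC powR_inv1 ?powR_ge0.
Qed.

Lemma monic_orthogonal_exists (R : realFieldType) (L : {scalar {poly R}})
    (n : nat) :
  (forall p : {poly R}, p != 0 -> 0 < L (p ^+ 2)) ->
  exists e : {poly R}, [/\ e \is monic, size e = n.+1 & orthogonal_below L n e].
Proof.
move=> Lpos; pose l (i : 'I_n) (p : {poly R}) := L (p * 'X^i).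
have lexp (p g : {poly R}) : (size g <= n)%N ->
    L (p * g) = \sum_(i < n) g`_i * l i p.
  move=> sg; rewrite -{1}(coefK g) poly_def mulr_sumr linear_sum.
  rewrite (big_ord_widen _ (fun i => L (p * (g`_i *: 'X^i))) sg).
  rewrite big_mkcond; apply: eq_bigr => i _; case: ltnP => [ig|gi].
    by rewrite -scalerAr linearZ.
  by rewrite nth_default // mul0r.
have [|p ps0 lp0|r sr lr] := @solve_functionals R n l (fun i => - l i 'X^n).
- by move=> i c p q; rewrite /l mulrDl -scalerAl linearP.
- apply/eqP; case: eqVneq => // /Lpos; rewrite expr2 lexp // big1 ?ltxx // => i _.
  by rewrite lp0 mulr0.
have srX : (size r < size ('X^n : {poly R}))%N by rewrite size_polyXn ltnS.
exists ('X^n + r); split.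
- by rewrite monicE lead_coefDl // lead_coefXn.
- by rewrite size_polyDl // size_polyXn.
- move=> g sg; rewrite lexp // big1 // => i _.
  by rewrite /l mulrDl linearD -/(l i r) lr /= addrN mulr0.
Qed.

(** Quadratic forms on a finite-dimensional space are comparable when the dominating one is
    definite. Instead of compactness, the induction splits p = c e + r orthogonally for [L']: the
    cross term disappears on the right, and on the left it costs the factor 2 of (x + y)^2 <= 2 x^2
    + 2 y^2. *)
Lemma square_functional_bound (R : realFieldType) (L L' : {scalar {poly R}})
    (n : nat) :
  (forall p : {poly R}, 0 <= L (p ^+ 2)) ->
  (forall p : {poly R}, p != 0 -> 0 < L' (p ^+ 2)) ->
  exists2 K, 0 < K &
    forall p : {poly R}, (size p <= n)%N -> L (p ^+ 2) <= K * L' (p ^+ 2).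
Proof.
move=> L0 L'0; elim: n => [|n [K K0 IH]].
  exists 1 => // p; rewrite leqn0 size_poly_eq0 => /eqP->.
  by rewrite expr0n /= !linear0 mulr0.
have [e [me se oe]] := monic_orthogonal_exists n L'0.
have e0 : 0 < L' (e ^+ 2) by rewrite L'0 // monic_neq0.
pose k := L (e ^+ 2) / L' (e ^+ 2).
have k0 : 0 <= k by rewrite divr_ge0 // ltW.
exists (2 * k + 2 * K); first lra.
move=> p sp; pose c := p`_n; pose r := p - c *: e.
have sr : (size r <= n)%N.
  apply/leq_sizeP => j; rewrite leq_eqVlt => /predU1P[<-|nj].
    rewrite /r coefB coefZ -/c.
    move: me; rewrite monicE lead_coefE se /= => /eqP ->.
    by rewrite mulr1 subrr.
  rewrite /r coefB coefZ !nth_default ?mulr0 ?subr0 ?se //.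
  exact: leq_trans nj.
have pE : p = c *: e + r by rewrite /r addrC subrK.
have Lp : L (p ^+ 2) <= 2 * (c ^+ 2 * L (e ^+ 2)) + 2 * L (r ^+ 2).
  have -> : 2 * (c ^+ 2 * L (e ^+ 2)) + 2 * L (r ^+ 2) =
      L (p ^+ 2) + L ((c *: e - r) ^+ 2).
    rewrite -linearD pE.
    have -> : (c *: e + r) ^+ 2 + (c *: e - r) ^+ 2 =
        (2 * c ^+ 2) *: (e ^+ 2) + 2 *: (r ^+ 2).
      by rewrite -!mul_polyC; ring.
    by rewrite linearD !linearZ /= mulrA.
  by rewrite lerDl.
have L'p : L' (p ^+ 2) = c ^+ 2 * L' (e ^+ 2) + L' (r ^+ 2).
  have -> : p ^+ 2 = (c ^+ 2) *: (e ^+ 2) + (2 * c) *: (e * r) + r ^+ 2.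
    by rewrite {1}pE -!mul_polyC; ring.
  by rewrite !linearD !linearZ /= oe // mulr0 addr0.
apply: (le_trans Lp); rewrite L'p.
have keE : L (e ^+ 2) = k * L' (e ^+ 2) by rewrite /k divfK // gt_eqF.
rewrite keE; have rK := IH r sr.
have r0 : 0 <= L' (r ^+ 2).
  by have [->|/L'0/ltW//] := eqVneq r 0; rewrite expr0n /= linear0.
have h1 : 0 <= k * L' (r ^+ 2) by rewrite mulr_ge0.
have h2 : 0 <= K * (c ^+ 2 * L' (e ^+ 2)).
  by rewrite mulr_ge0 ?(ltW K0) // mulr_ge0 ?sqr_ge0 ?(ltW e0).
lra.
Qed.

(* On ]0, b - h] the factor u^gamma is exponentially smaller than near b - h / 2,
   whereas E (p^2) is controlled by the values of p near b, the degree of p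
   being bounded. *)
Lemma square_concentration (R : realType) (b d eps : R) (E : (R -> R) -> R)
    (n N : nat) :
  positive_functional b E -> 0 < d -> 0 < eps ->
  exists2 G : R, 2 <= G & forall (gamma : R) (xi : 'I_n -> R) (p : {poly R}),
    G <= gamma -> (forall j, 0 < xi j < d) -> (size p <= N)%N ->
    E (fun u => (b - u) * p.[u] ^+ 2 * ((nodal (fun j => - xi j)).[u] * u `^ (gamma - 2)))
    <= eps * E (fun u => p.[u] ^+ 2 * ((nodal (fun j => - xi j)).[u] * u `^ gamma)).
Proof.
move=> EP d0 eps0; have b0 := functional_dom EP.
(* The first bound gives m >= b/2, hence m^2 >= b^2/4; with the second, h / m^2 <= eps/2, the share
   allotted to the part of the integral beyond [m]. *)
pose h := Num.min (b / 2) (eps * b ^+ 2 / 8).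
have h0 : 0 < h by rewrite lt_min !divr_gt0 // mulr_gt0 // exprn_gt0.
have hb : h <= b / 2 by rewrite ge_min lexx.
have he : h <= eps * b ^+ 2 / 8 by rewrite ge_min lexx orbT.
pose m := b - h; pose m' := b - h / 2.
have m0 : 0 < m by rewrite /m; lra.
have mm' : m < m' by rewrite /m /m'; lra.
have m'0 : 0 < m' by exact: lt_trans mm'.
have m'b : m' < b by rewrite /m'; lra.
have hm : h / m ^+ 2 <= eps / 2.
  rewrite ler_pdivrMr ?exprn_gt0 //; apply: (le_trans he).
  have : b ^+ 2 / 4 <= m ^+ 2.
    have -> : b ^+ 2 / 4 = (b / 2) ^+ 2 by field.
    by rewrite lerXn2r ?nnegrE ?divr_ge0 ?(ltW b0) ?(ltW m0) // /m; lra.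
  by move=> /(ler_wpM2l (ltW eps0)); lra.
(* A continuous weight supported beyond [m']. Comparing the plain integral of p^2 with the one
   against [psi] gives a constant K that depends on the degree bound only, not on [gamma] or
   [xi]. *)
pose psi u := Num.max (u - m') 0.
have apsi : admissible b psi.
  have aum : admissible b (fun u => u - m').
    by apply: admissibleD; [exact: admissible_id | exact: admissible_cst].
  split; first by apply: measurable_maxr => //; exact: aum.1.
  have [M HM] := aum.2; exists M => u ub; rewrite /psi.
  have uM := HM u ub.
  by case: (leP (u - m') 0) => _ //; rewrite normr0 (le_trans _ uM).
have a1 := admissible_cst b (1 : R).
have [L LE] := poly_functional EP a1.
have [L' LE'] := poly_functional EP apsi.
have [||K K0 KE] := @square_functional_bound R L L' N.
- move=> p; rewrite LE; apply: (functional_ge0 EP) => u _.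
  by rewrite mulr1 horner_exp sqr_ge0.
- move=> p p0; rewrite LE'; apply: (functional_gt0 (c := m') EP _ p0).
  + by apply: admissibleM => //; exact: admissible_horner.
  + by rewrite ltW.
  + by move=> u _; rewrite horner_exp mulr_ge0 ?sqr_ge0 // le_max lexx orbT.
  + move=> u; rewrite in_itv/= => /andP[um _] ru.
    by rewrite horner_exp mulr_gt0 ?exprn_even_gt0 // lt_max subr_gt0 um.
pose Cmax := (b + d) ^+ n.
have Cmax0 : 0 < Cmax by rewrite exprn_gt0 // addr_gt0.
(* All factors that do not depend on [gamma] in the bound of the part below [m]; what remains is
   q^gamma with q = m / m' < 1. *)
pose A := b * Cmax * K * b / (m ^+ 2 * m' ^+ n).
have A0 : 0 < A.
  by rewrite divr_gt0 // ?mulr_gt0 // ?mulr_gt0 ?exprn_gt0 // mulr_gt0.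
pose q := m / m'.
have q0 : 0 < q by rewrite divr_gt0.
have q1 : q < 1 by rewrite ltr_pdivrMr // mul1r.
have lq : ln q < 0 by rewrite ln_lt0 // q0 q1.
have e0 : 0 < eps / 2 / A by rewrite divr_gt0 // divr_gt0.
(* The second entry solves A q^gamma <= eps/2, the inequality turning because ln q < 0. The first
   keeps u^(gamma - 2) bounded near 0. *)
exists (Num.max 2 (ln (eps / 2 / A) / ln q)); first by rewrite le_max lexx.
move=> gamma xi p; rewrite ge_max => /andP[g2 gG] xid sp.
set C := nodal _.
have qg : A * q `^ gamma <= eps / 2.
  rewrite mulrC -ler_pdivlMr // /powR gt_eqF // -[leRHS]lnK ?posrE //.
  by rewrite ler_expR -ler_ndivrMr.
have Cu u : u \in `]0, b[ -> u ^+ n <= C.[u] <= Cmax.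
  rewrite in_itv/= => /andP[u0 ub]; rewrite /C horner_nodal.
  have E0 k : u ^+ k = \prod_(i < k) u by rewrite prodr_const card_ord.
  rewrite /Cmax E0 -[in (b + d) ^+ n](card_ord n) -prodr_const.
  apply/andP; split; apply: ler_prod => i _; rewrite opprK.
    by rewrite (ltW u0) lerDl; case/andP: (xid i) => /ltW.
  by case/andP: (xid i) => x0 xd; lra.
have C0 u : u \in `]0, b[ -> 0 <= C.[u].
  move=> ub; case/andP: (Cu u ub) => + _; apply: le_trans.
  by move: ub; rewrite in_itv/= => /andP[/ltW u0 _]; exact: exprn_ge0.
have ap : admissible b (fun u => p.[u] ^+ 2).
  by under eq_fun do rewrite -horner_exp; exact: admissible_horner.
have aC : admissible b (fun u => C.[u]) by exact: admissible_horner.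
have g0 : 0 <= gamma by lra.
have aw : admissible b (fun u => p.[u] ^+ 2 * (C.[u] * u `^ gamma)).
  by do 2! apply: admissibleM => //; exact: admissible_powR.
have aw2 : admissible b (fun u => (b - u) * p.[u] ^+ 2 * (C.[u] * u `^ (gamma - 2))).
  apply: admissibleM; apply: admissibleM => //.
    under eq_fun do rewrite -mulN1r; apply: admissibleD; first exact: admissible_cst.
    by apply: admissibleM; [exact: admissible_cst | exact: admissible_id].
  by apply: admissible_powR; rewrite subr_ge0.
set W := E (fun u => p.[u] ^+ 2 * (C.[u] * u `^ gamma)).
have W0 : 0 <= W.
  apply: (functional_ge0 EP) => u ub.
  by rewrite mulr_ge0 ?sqr_ge0 // mulr_ge0 ?C0 ?powR_ge0.
(* On the support of [psi] the true weight is at least m'^n m'^gamma, and psi <= b; so the plain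
   integral of p^2 is controlled by [W]. *)
have P2 : E (fun u => p.[u] ^+ 2 * 1) <= K * (b / (m' ^+ n * m' `^ gamma) * W).
  have -> : E (fun u => p.[u] ^+ 2 * 1) = L (p ^+ 2).
    by rewrite LE; congr E; apply/funext => u; rewrite horner_exp.
  apply: (le_trans (KE p sp)); rewrite ler_pM2l // LE' -(functionalZ EP) //.
  apply: (functional_le EP).
  - by apply: admissibleM => //; exact: admissible_horner.
  - by apply: admissibleM => //; exact: admissible_cst.
  move=> u ub; rewrite horner_exp mulrCA ler_wpM2l ?sqr_ge0 // mulrAC.
  have mg0 : 0 < m' `^ gamma by rewrite powR_gt0.
  rewrite ler_pdivlMr ?mulr_gt0 ?exprn_gt0 //.
  have [u0 ub'] : 0 < u /\ u < b by move: ub; rewrite in_itv/= => /andP[].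
  have [um|um] := leP u m'.
    rewrite /psi max_r ?subr_le0 // mul0r.
    by rewrite ?mulr_ge0 // ?mulr_ge0 // ?mulr_ge0 // ?C0 ?powR_ge0 // ltW.
  rewrite /psi max_l ?subr_ge0 ?(ltW um) //.
  rewrite ler_pM ?subr_ge0 ?(ltW um) ?mulr_ge0 ?exprn_ge0 ?powR_ge0 ?(ltW m'0) //.
    lra.
  apply: ler_pM; rewrite ?exprn_ge0 ?powR_ge0 ?(ltW m'0) //.
    have /andP[+ _] := Cu u ub; apply: le_trans.
    by rewrite lerXn2r ?nnegrE ?(ltW m'0) ?(ltW u0) ?(ltW um).
  by apply: ge0_ler_powR; rewrite ?nnegrE ?(ltW m'0) ?(ltW u0) ?(ltW um).
pose B := b * m `^ (gamma - 2) * Cmax.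
have B0 : 0 <= B by rewrite ?mulr_ge0 // ?mulr_ge0 // ?mulr_ge0 // ?powR_ge0 // ltW.
(* The integral is cut at [m]: beyond it b - u <= h and u^(-2) <= m^(-2); below it u^(gamma - 2) is
   at most its value at [m], and [P2] takes over. *)
apply: (@le_trans _ _ (h / m ^+ 2 * W + B * E (fun u => p.[u] ^+ 2 * 1))).
  have ap1 : admissible b (fun u => p.[u] ^+ 2 * 1) by exact: admissibleM.
  have aZ c f : admissible b f -> admissible b (fun u => c * f u).
    by move=> af; apply: admissibleM => //; exact: admissible_cst.
  rewrite -!(functionalZ EP) // -(functionalD EP) //; [|exact: aZ|exact: aZ].
  apply: (functional_le EP) => //; first by apply: admissibleD; exact: aZ.
  move=> u ub; have [u0 ub'] : 0 < u /\ u < b by move: ub; rewrite in_itv/= => /andP[].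
  have /andP[_ CuM] := Cu u ub.
  have p20 : 0 <= p.[u] ^+ 2 by exact: sqr_ge0.
  have ug : u `^ (gamma - 2) = u `^ gamma / u ^+ 2.
    by rewrite powRB ?(gt_eqF u0) ?implybT // -[2]/(2%:R) powR_mulrn // ltW.
  have ug0 := powR_ge0 u gamma.
  have [um|um] := leP m u.
    apply: (@le_trans _ _ (h / m ^+ 2 * (p.[u] ^+ 2 * (C.[u] * u `^ gamma)))); last first.
      by rewrite lerDl mulr_ge0 // mulr1.
    rewrite ug.
    have -> : (b - u) * p.[u] ^+ 2 * (C.[u] * (u `^ gamma / u ^+ 2)) =
       ((b - u) / u ^+ 2) * (p.[u] ^+ 2 * (C.[u] * u `^ gamma)) by ring.
    apply: ler_wpM2r; first by rewrite mulr_ge0 // mulr_ge0 ?C0.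
    apply: ler_pM; rewrite ?invr_ge0 ?sqr_ge0 //.
        by clear - ub'; lra.
      by rewrite lerBlDl -lerBlDr.
    rewrite lef_pV2 ?posrE ?exprn_gt0 //.
    by rewrite lerXn2r ?nnegrE ?(ltW m0) ?(ltW u0).
  apply: (@le_trans _ _ (B * (p.[u] ^+ 2 * 1))); last first.
    rewrite lerDr mulr_ge0 ?divr_ge0 ?exprn_ge0 ?(ltW h0) ?(ltW m0) //.
    by rewrite mulr_ge0 // mulr_ge0 ?C0.
  have -> : (b - u) * p.[u] ^+ 2 * (C.[u] * u `^ (gamma - 2)) =
     ((b - u) * u `^ (gamma - 2) * C.[u]) * (p.[u] ^+ 2 * 1) by ring.
  apply: ler_wpM2r; first by rewrite mulr1.
  apply: ler_pM; rewrite ?mulr_ge0 ?powR_ge0 ?C0 //.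
    by clear - ub'; lra.
  apply: ler_pM; rewrite ?powR_ge0 //;
    [clear - ub'; lra | clear - u0; lra |].
  by apply: ge0_ler_powR; rewrite ?nnegrE; clear - g2 um u0 m0; lra.
apply: (@le_trans _ _ (eps / 2 * W + eps / 2 * W)); last by rewrite -mulrDl; lra.
apply: lerD; first by rewrite ler_wpM2r.
apply: (@le_trans _ _ (B * (K * (b / (m' ^+ n * m' `^ gamma) * W)))).
  by rewrite ler_wpM2l.
have -> : B * (K * (b / (m' ^+ n * m' `^ gamma) * W)) = A * q `^ gamma * W.
  have mg : m `^ (gamma - 2) = m `^ gamma / m ^+ 2.
    by rewrite powRB ?(gt_eqF m0) ?implybT // -[2]/(2%:R) powR_mulrn // ltW.
  have qE : q `^ gamma = m `^ gamma / m' `^ gamma.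
    by rewrite /q powR_div.
  rewrite /B /A mg qE; field.
  by rewrite !gt_eqF ?exprn_gt0 ?powR_gt0.
by rewrite ler_wpM2r.
Qed.

(** * Comparison of weights and of zeros *)

(* On ]0, b[ the polynomial of the theorem is, in the variable u = |x|, the
   product of nodal ups (its zeros in the interval) and of side_weight, which
   carries its zeros xi from the other interval. *)
Definition side_weight (R : realType) (n : nat) (xi : 'I_n -> R) (gamma u : R) : R :=
  (nodal (fun j => - xi j)).[u] * u `^ gamma.

Definition side_orthogonal (R : realType) (E : (R -> R) -> R) (n : nat)
    (gamma : R) (ups xi : 'I_n -> R) : Prop :=
  forall g : {poly R}, (size g <= n)%N ->
    E (fun u => (nodal ups * g).[u] * side_weight xi gamma u) = 0.

Lemma prod_sub1_bound (R : realFieldType) (n : nat) (f : 'I_n -> R) (F e : R) :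
  1 <= F -> 0 <= e -> (forall i, 0 <= f i <= F) -> (forall i, `|f i - 1| <= e) ->
  `|\prod_(i < n) f i - 1| <= n%:R * F ^+ n * e.
Proof.
move=> F1 e0; have F0 : 0 <= F by exact: le_trans ler01 F1.
elim: n f => [f _ _|n IH f f0F fe].
  by rewrite big_ord0 subrr normr0 !mul0r.
rewrite big_ord_recr /=; set a := \prod_(i < n) _.
have aF : 0 <= a <= F ^+ n.
  apply/andP; split; first by apply: prodr_ge0 => i _; case/andP: (f0F (widen_ord (leqnSn n) i)).
  rewrite -[in X in _ <= X](card_ord n) -prodr_const.
  by apply: ler_prod => i _; exact: f0F.
have a1 : `|a - 1| <= n%:R * F ^+ n * e by apply: IH.
have -> : a * f ord_max - 1 = a * (f ord_max - 1) + (a - 1) by ring.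
apply: (le_trans (ler_normD _ _)); rewrite normrM.
have /andP[a0 aFn] := aF.
have h1 : `|a| * `|f ord_max - 1| <= F ^+ n * e.
  by rewrite (ger0_norm a0); apply: ler_pM.
have h2 : F ^+ n * e <= F ^+ n.+1 * e.
  by rewrite ler_wpM2r // exprSr ler_peMr // exprn_ge0.
have h3 : n%:R * F ^+ n * e <= n%:R * F ^+ n.+1 * e.
  by rewrite -!mulrA ler_wpM2l.
rewrite -natr1 mulrDl mul1r mulrDl; lra.
Qed.

Lemma expR_sub1_bound (R : realType) (x : R) : `|expR x - 1| <= `|x| * expR `|x|.
Proof.
have [x0|x0] := leP 0 x.
  have e1 : 0 <= expR x - 1 by rewrite subr_ge0 -expR0 ler_expR.
  rewrite (ger0_norm e1) (ger0_norm x0).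
  have := expR_ge1Dx (- x); rewrite expRN => h.
  have e0 := expR_gt0 x.
  have : (1 + - x) * expR x <= 1.
    by rewrite -[leRHS](@mulVf _ (expR x)) ?gt_eqF // ler_wpM2r // ltW.
  lra.
have ex1 : expR x - 1 < 0 by rewrite subr_lt0 expR_lt1.
rewrite (ltr0_norm ex1) (ltr0_norm x0).
have := expR_ge1Dx x; have : 1 <= expR (- x) by rewrite -expR0 ler_expR oppr_ge0 ltW.
move=> h1 h2; have : (- x) * 1 <= (- x) * expR (- x).
  by rewrite ler_wpM2l // oppr_ge0 ltW.
lra.
Qed.

Lemma ln_ge_sub (R : realType) (u v : R) : 0 < u -> 0 < v -> 1 - u / v <= ln (v / u).
Proof.
move=> u0 v0; have uv0 : 0 < u / v by rewrite divr_gt0.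
have h := @le_ln1Dx R (u / v - 1); have e : 1 + (u / v - 1) = u / v by ring.
have : ln (u / v) <= u / v - 1 by rewrite -{1}e h //; lra.
have -> : v / u = (u / v)^-1 by rewrite invf_div.
rewrite lnV ?posrE //; lra.
Qed.

(** With l = ln(v/u), the bound v >= b/2 > u/2 gives |l| <= 2|u - v|/u and exp|l| <= 2b/u. As u may
    approach 0, these two factors produce the loss u^(-2). *)
Lemma powR_ratio_bound (R : realType) (b u v d : R) :
  0 < u -> u < b -> b / 2 <= v -> v <= b -> `|d| <= 1 ->
  `|(v / u) `^ d - 1| <= 4 * b * `|d| * `|u - v| / u ^+ 2 /\ (v / u) `^ d <= 2 * b / u.
Proof.
move=> u0 ub bv vb d1; have b0 : 0 < b by lra.
have v0 : 0 < v by lra.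
have r0 : 0 < v / u by rewrite divr_gt0.
have -> : (v / u) `^ d = expR (d * ln (v / u)) by rewrite /powR gt_eqF.
set l := ln (v / u).
have l1 := ln_ge_sub u0 v0; have l2 := ln_ge_sub v0 u0.
have lE : ln (u / v) = - l by rewrite /l -[u / v]invf_div lnV // posrE divr_gt0.
rewrite lE in l2; rewrite -/l in l1.
have uE : 1 - u / v = (v - u) / v by field; rewrite gt_eqF.
have vE : 1 - v / u = (u - v) / u by field; rewrite gt_eqF.
rewrite uE in l1; rewrite vE in l2.
have vu : v^-1 <= 2 / u.
  rewrite ler_pdivlMr // mulrC ler_pdivrMr //; lra.
have nuv : 0 <= `|u - v| by [].
have la : `|l| <= 2 * `|u - v| / u.
  have h1 : `|u - v| / u <= 2 * `|u - v| / u.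
    by rewrite ler_wpM2r ?invr_ge0 ?(ltW u0) // ler_peMl // ler1n.
  have h2 : `|u - v| / v <= 2 * `|u - v| / u.
    by rewrite [2 * _]mulrC -mulrA ler_wpM2l.
  have h3 : (u - v) / u >= - (`|u - v| / u).
    by rewrite -mulNr ler_wpM2r ?invr_ge0 ?(ltW u0) // lerNl ler_normr lexx orbT.
  have h4 : (v - u) / v >= - (`|u - v| / v).
    by rewrite -mulNr ler_wpM2r ?invr_ge0 ?(ltW v0) // lerNl ler_normr opprB lexx.
  rewrite ler_norml; apply/andP; split; lra.
have el : expR `|l| <= 2 * b / u.
  have [l0|l0] := leP 0 l.
    rewrite (ger0_norm l0) /l lnK ?posrE // ler_wpM2r ?invr_ge0 ?(ltW u0) //; lra.
  rewrite (ltr0_norm l0) -lE lnK ?posrE ?divr_gt0 //.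
  rewrite ler_pdivrMr // mulrAC ler_pdivlMr //.
  have : u * u <= u * b by rewrite ler_wpM2l ?ltW.
  have : b * (b / 2) <= b * v by rewrite ler_wpM2l ?(ltW b0).
  have : u * b <= b * b by rewrite ler_wpM2r ?ltW.
  lra.
have xl : `|d * l| <= `|l| by rewrite normrM ler_piMl.
have ex : expR `|d * l| <= 2 * b / u.
  by apply: le_trans el; rewrite ler_expR.
split; last first.
  by apply: le_trans ex; rewrite ler_expR ler_norm.
apply: (le_trans (expR_sub1_bound _)).
have -> : 4 * b * `|d| * `|u - v| / u ^+ 2 =
    (`|d| * (2 * `|u - v| / u)) * (2 * b / u) by field; rewrite gt_eqF.
apply: ler_pM; rewrite ?expR_ge0 //.
by rewrite normrM ler_wpM2l.
Qed.

Lemma side_weight_gt0 (R : realType) (n : nat) (xi : 'I_n -> R) (gamma u : R) :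
  (forall j, 0 < xi j) -> 0 < u -> 0 < side_weight xi gamma u.
Proof.
move=> x0 u0; rewrite mulr_gt0 ?powR_gt0 // horner_nodal.
by apply: prodr_gt0 => i _; rewrite opprK addr_gt0.
Qed.

Lemma admissible_side_weight (R : realType) (b : R) (n : nat) (xi : 'I_n -> R)
    (gamma : R) :
  0 <= gamma -> admissible b (side_weight xi gamma).
Proof.
move=> g0; apply: admissibleM; first exact: admissible_horner.
exact: admissible_powR.
Qed.

(** The first weight, rescaled to agree with the second at [v], equals the second times S r, where S
    is the product of the ratios of the factors u + xi_j and r is a ratio of powers. Both are 1 at u
    = v and differ from 1 in proportion to |u - v| and to the change of parameters. *)
Lemma side_weight_compare (R : realType) (b d : R) (n : nat) : 0 < b -> 0 < d ->
  exists2 K, 0 < K & forall (xi1 xi2 : 'I_n -> R) (D gamma1 gamma2 u v : R),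
    (forall j, d / 2 <= xi1 j <= d) -> (forall j, d / 2 <= xi2 j <= d) ->
    (forall j, `|xi2 j - xi1 j| <= D) -> 0 <= D -> `|gamma2 - gamma1| <= 1 ->
    0 < u -> u < b -> b / 2 <= v -> v <= b ->
    `|side_weight xi2 gamma2 u - side_weight xi2 gamma2 v
        / side_weight xi1 gamma1 v * side_weight xi1 gamma1 u| <=
    K * (`|gamma2 - gamma1| + D) * `|u - v| * side_weight xi2 (gamma2 - 2) u.
Proof.
(* [F] bounds each ratio [f j]: its numerator is at most (b + d)^2 and its denominator at least
   (b/2)(d/2). *)
move=> b0 d0; pose F := 4 * (b + d) ^+ 2 / (b * d).
have bd0 : 0 < b * d by rewrite mulr_gt0.
have F1 : 1 <= F.
  rewrite ler_pdivlMr // mul1r sqrrD.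
  have := sqr_ge0 b; have := sqr_ge0 d; lra.
have Fn0 : 0 < F ^+ n by rewrite exprn_gt0 // (lt_le_trans ltr01).
(* From (2b/u) n F^n 4/(bd), with one extra factor b/u >= 1 to reach the common power u^(-2). *)
pose K2 := 8 * n%:R * F ^+ n * (b / d).
have K20 : 0 <= K2.
  by rewrite mulr_ge0 ?divr_ge0 ?(ltW b0) ?(ltW d0) // mulr_ge0 ?(ltW Fn0) // mulr_ge0.
exists (4 * b + K2); first by rewrite ltr_wpDr // mulr_gt0.
move=> xi1 xi2 D g1 g2 u v x1 x2 xD D0 g12 u0 ub bv vb.
have v0 : 0 < v by lra.
have xi1_0 j : 0 < xi1 j by have /andP[h _] := x1 j; lra.
have xi2_0 j : 0 < xi2 j by have /andP[h _] := x2 j; lra.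
have [] := powR_ratio_bound u0 ub bv vb g12.
set r := (v / u) `^ _; set de := `|g2 - g1|; set t := `|u - v| => rb r2b.
have t0 : 0 <= t by exact: normr_ge0.
pose f j := (v + xi2 j) * (u + xi1 j) / ((v + xi1 j) * (u + xi2 j)).
pose S := \prod_(j < n) f j.
have fF j : 0 <= f j <= F.
  have /andP[h1 h2] := x1 j; have /andP[h3 h4] := x2 j.
  have p1 : 0 < (v + xi1 j) * (u + xi2 j) by rewrite mulr_gt0 // addr_gt0.
  apply/andP; split.
    by rewrite divr_ge0 ?(ltW p1) // mulr_ge0 // addr_ge0 // ltW.
  rewrite ler_pdivrMr // /F mulrAC ler_pdivlMr //.
  have q1 : (v + xi2 j) * (u + xi1 j) <= (b + d) ^+ 2.
    rewrite expr2; clear - h1 h2 h3 h4 u0 ub v0 vb d0.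
    by apply: ler_pM; lra.
  have q2 : b * d <= 4 * ((v + xi1 j) * (u + xi2 j)).
    clear - h1 h3 u0 bv b0 d0.
    have : (b / 2) * (d / 2) <= (v + xi1 j) * (u + xi2 j) by apply: ler_pM; lra.
    lra.
  rewrite -[4 * _ * _]mulrA [4 * _]mulrCA.
  by apply: ler_pM => //; [by rewrite mulr_ge0 // addr_ge0 // ltW | exact: ltW].
have fe j : `|f j - 1| <= t * D * (4 / (b * d)).
  have /andP[h1 h2] := x1 j; have /andP[h3 h4] := x2 j.
  have p1 : 0 < v + xi1 j by lra.
  have p2 : 0 < u + xi2 j by lra.
  have -> : f j - 1 = ((u - v) * (xi2 j - xi1 j)) / ((v + xi1 j) * (u + xi2 j)).
    by rewrite /f; field; rewrite !gt_eqF.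
  rewrite normrM normrM normfV (gtr0_norm (mulr_gt0 p1 p2)).
  apply: ler_pM; rewrite ?invr_ge0 ?mulr_ge0 ?(ltW p1) ?(ltW p2) //.
    by rewrite ler_wpM2l.
  have -> : 4 / (b * d) = ((b / 2) * (d / 2))^-1 by field; rewrite !gt_eqF.
  rewrite lef_pV2 ?posrE ?mulr_gt0 // ?divr_gt0 //.
  by clear - h1 h3 u0 bv b0 d0; apply: ler_pM; lra.
have e0 : 0 <= t * D * (4 / (b * d)) by apply: mulr_ge0; [exact: mulr_ge0 | rewrite divr_ge0 // ltW].
have Sb := prod_sub1_bound F1 e0 fF fe; rewrite -/S in Sb.
have Ssw : side_weight xi2 g2 v / side_weight xi1 g1 v * side_weight xi1 g1 u =
    S * r * side_weight xi2 g2 u.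
  rewrite /side_weight !horner_nodal /S /f.
  rewrite [\prod_(j < n) (_ / _)]big_split prodfV /= !big_split /=.
  under [\prod_(i < n) (v - - xi2 i)]eq_bigr do rewrite opprK.
  under [\prod_(i < n) (v - - xi1 i)]eq_bigr do rewrite opprK.
  under [\prod_(i < n) (u - - xi2 i)]eq_bigr do rewrite opprK.
  under [\prod_(i < n) (u - - xi1 i)]eq_bigr do rewrite opprK.
  have P (x : 'I_n -> R) z : (forall j, 0 < x j) -> 0 < z -> \prod_(i < n) (z + x i) != 0.
    by move=> x0 z0; rewrite gt_eqF //; apply: prodr_gt0 => i _; rewrite addr_gt0.
  have N1 := P _ _ xi1_0 v0; have N2 := P _ _ xi2_0 u0.
  have rE : r = v `^ g2 / v `^ g1 * (u `^ g1 / u `^ g2).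
    by rewrite /r powR_div // !powRB ?(gt_eqF u0) ?(gt_eqF v0) ?implybT // invf_div.
  have M1 : v `^ g1 != 0 by rewrite gt_eqF // powR_gt0.
  have M2 : u `^ g2 != 0 by rewrite gt_eqF // powR_gt0.
  by rewrite rE; field; rewrite N1 N2 M1 M2.
have W0 := side_weight_gt0 g2 xi2_0 u0.
have WE : side_weight xi2 (g2 - 2) u = side_weight xi2 g2 u / u ^+ 2.
  rewrite /side_weight powRB ?(gt_eqF u0) ?implybT // -[2]/(2%:R) powR_mulrn ?(ltW u0) //.
  by rewrite mulrA.
rewrite Ssw WE -{1}[side_weight xi2 g2 u]mul1r -mulrBl normrM (gtr0_norm W0).
rewrite [in leRHS]mulrCA mulrC ler_pM2l //.
have rr0 : 0 <= r by exact: powR_ge0.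
have -> : 1 - S * r = - ((r - 1) + r * (S - 1)) by ring.
rewrite normrN; apply: (le_trans (ler_normD _ _)); rewrite normrM (ger0_norm rr0).
have h2 : r * `|S - 1| <= (2 * b / u) * (n%:R * F ^+ n * (t * D * (4 / (b * d)))).
  by apply: ler_pM.
have h3 : (2 * b / u) * (n%:R * F ^+ n * (t * D * (4 / (b * d)))) <= K2 * D * t / u ^+ 2.
  have -> : K2 * D * t / u ^+ 2 =
      (2 * b / u) * (n%:R * F ^+ n * (t * D * (4 / (b * d)))) * (b / u).
    by rewrite /K2; field; rewrite !gt_eqF.
  apply: ler_peMr; last by rewrite ler_pdivlMr // mul1r ltW.
  by apply: mulr_ge0; [rewrite divr_ge0 ?mulr_ge0 ?ltW | rewrite mulr_ge0 // mulr_ge0 // ltW].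
have u20 : 0 <= (u ^+ 2)^-1 by rewrite invr_ge0 sqr_ge0.
have de0 : 0 <= de by exact: normr_ge0.
have h4 : 0 <= (K2 * de + 4 * b * D) * t / u ^+ 2.
  by rewrite mulr_ge0 // mulr_ge0 // addr_ge0 // mulr_ge0 // mulr_ge0 // ltW.
have -> : (4 * b + K2) * (de + D) * t / u ^+ 2 =
  4 * b * de * t / u ^+ 2 + K2 * D * t / u ^+ 2 + (K2 * de + 4 * b * D) * t / u ^+ 2 by ring.
clear - rb h2 h3 h4; lra.
Qed.

Section OneSide.
Variables (R : realType) (b d : R) (E : (R -> R) -> R) (n : nat).
Hypotheses (EP : positive_functional b E) (d0 : 0 < d).
Let b0 : 0 < b := functional_dom EP.

Lemma side_functional (xi : 'I_n -> R) (gamma : R) :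
  0 <= gamma -> (forall j, 0 < xi j) ->
  exists L : {scalar {poly R}},
    [/\ forall p, L p = E (fun u => p.[u] * side_weight xi gamma u),
        forall p, 0 <= L (p ^+ 2) &
        forall p, p != 0 -> 0 < L (p ^+ 2)].
Proof.
move=> g0 x0; have aw := admissible_side_weight b xi g0.
have [L LE] := poly_functional EP aw; exists L.
have Lpos p : p != 0 -> 0 < L (p ^+ 2).
  move=> p0; rewrite LE; under eq_fun do rewrite horner_exp.
  apply: (functional_square_gt0 EP) => // u; rewrite in_itv/= => /andP[u0 _].
  exact: side_weight_gt0.
split=> // p; have [->|/Lpos/ltW//] := eqVneq p 0.
by rewrite expr0n /= linear0.
Qed.

Definition ordered_in (c : R) (x : 'I_n -> R) : Prop :=
  {homo x : i j / (i < j)%N >-> i < j} /\ forall i, 0 < x i < c.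

(** A zero is a Rayleigh quotient: with [l] the nodal polynomial deprived of the factor at ups_i,
    orthogonality gives b - ups_i = L((b - u) l^2) / L(l^2), which concentration bounds. The factor
    b^2 comes from u^gamma <= b^2 u^(gamma - 2). *)
Lemma zeros_near_end (eps gamma : R) (ups xi : 'I_n -> R) :
  0 <= gamma - 2 -> ordered_in b ups -> (forall j, 0 < xi j < d) ->
  side_orthogonal E gamma ups xi ->
  (forall p : {poly R}, (size p <= n.+1)%N ->
    E (fun u => (b - u) * p.[u] ^+ 2 * side_weight xi (gamma - 2) u)
      <= eps * E (fun u => p.[u] ^+ 2 * side_weight xi gamma u)) ->
  forall i, b - ups i <= b ^+ 2 * eps.
Proof.
move=> g2 [uh ub] xd orth conc i.
have g0 : 0 <= gamma by lra.
have x0 j : 0 < xi j by case/andP: (xd j).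
have [L [LE _ Lpos]] := side_functional g0 x0.
pose l := \prod_(j < n | j != i) ('X - (ups j)%:P).
have sl : size l = n.
  by rewrite size_prod_XsubC_cond cardC1 card_ord prednK // (leq_ltn_trans _ (ltn_ord i)).
have l0 : l != 0 by rewrite -size_poly_gt0 sl (leq_ltn_trans _ (ltn_ord i)).
have nE : nodal ups = ('X - (ups i)%:P) * l by rewrite /nodal (bigD1 i).
have L1 : L (('X - (ups i)%:P) * l ^+ 2) = 0.
  by rewrite expr2 mulrA -nE LE orth // sl.
have L2 : (b - ups i) * L (l ^+ 2) = L ((b%:P - 'X) * l ^+ 2).
  rewrite -linearZ -[RHS]addr0 -L1 -linearD; congr (L _).
  by rewrite -mul_polyC rmorphB /=; ring.
have L3 : L ((b%:P - 'X) * l ^+ 2) <= b ^+ 2 * eps * L (l ^+ 2).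
  have aw := admissible_side_weight b xi g2.
  have al : admissible b (fun u => (b - u) * l.[u] ^+ 2 * side_weight xi (gamma - 2) u).
    apply: admissibleM => //.
    have -> : (fun u => (b - u) * l.[u] ^+ 2) = (fun u => ((b%:P - 'X) * l ^+ 2).[u]).
      by apply/funext => u; rewrite !hornerE.
    exact: admissible_horner.
  rewrite -mulrA; apply: (@le_trans _ _ (b ^+ 2 *
      E (fun u => (b - u) * l.[u] ^+ 2 * side_weight xi (gamma - 2) u))); last first.
    rewrite ler_wpM2l ?sqr_ge0 // LE; under [in leRHS]eq_fun do rewrite horner_exp.
    by apply: conc; rewrite sl.
  rewrite -(functionalZ EP) // LE; apply: (functional_le EP).
  - apply: admissibleM; first exact: admissible_horner.
    exact: admissible_side_weight.
  - by apply: admissibleM => //; exact: admissible_cst.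
  move=> u; rewrite in_itv/= => /andP[u0 ub'].
  have -> : side_weight xi gamma u = u ^+ 2 * side_weight xi (gamma - 2) u.
    rewrite /side_weight powRB ?(gt_eqF u0) ?implybT // -[2]/(2%:R).
    rewrite powR_mulrn ?(ltW u0) //; field; rewrite gt_eqF //.
  have -> : ((b%:P - 'X) * l ^+ 2).[u] = (b - u) * l.[u] ^+ 2 by rewrite !hornerE.
  rewrite mulrCA ler_wpM2r //; last by rewrite lerXn2r ?nnegrE ?ltW.
  apply: mulr_ge0; last by rewrite ltW // side_weight_gt0.
  by rewrite mulr_ge0 ?sqr_ge0 // subr_ge0 ltW.
move: L3; rewrite -L2 ler_pM2r //; exact: Lpos.
Qed.

Lemma zeros_eventually_near_end (eps : R) : 0 < eps ->
  exists2 G : R, 2 <= G & forall (gamma : R) (ups xi : 'I_n -> R),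
    G <= gamma -> ordered_in b ups -> (forall j, 0 < xi j < d) ->
    side_orthogonal E gamma ups xi -> forall i, b - ups i <= eps.
Proof.
move=> eps0; have e0 : 0 < eps / b ^+ 2 by rewrite divr_gt0 ?exprn_gt0.
have [G G2 HG] := square_concentration n n.+1 EP d0 e0.
exists G => // gamma ups xi gG uo xd orth i.
have -> : eps = b ^+ 2 * (eps / b ^+ 2) by field; rewrite gt_eqF.
by apply: (zeros_near_end _ uo xd orth) => [|p sp]; [lra | exact: HG].
Qed.

(** Only an upper bound on ups2 - ups1 is proved: the hypotheses are symmetric in the two states, so
    exchanging them yields the lower bound. *)
Lemma zeros_one_sided_lipschitz (eps : R) : 0 < eps ->
  exists2 G : R, 2 <= G &
  forall (gamma1 gamma2 D : R) (ups1 ups2 xi1 xi2 : 'I_n -> R),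
    G <= gamma1 -> G <= gamma2 -> `|gamma2 - gamma1| <= 1 ->
    ordered_in b ups1 -> ordered_in b ups2 ->
    (forall j, d / 2 <= xi1 j < d) -> (forall j, d / 2 <= xi2 j < d) ->
    (forall j, `|xi2 j - xi1 j| <= D) -> 0 <= D ->
    side_orthogonal E gamma1 ups1 xi1 -> side_orthogonal E gamma2 ups2 xi2 ->
    forall k, ups2 k - ups1 k <= eps * (`|gamma2 - gamma1| + D).
Proof.
move=> eps0; have [K K0 HK] := side_weight_compare n b0 d0.
(* The first entry forces v >= b/2, as the comparison of weights requires; the second absorbs the
   factor 3 K b of the final estimate. *)
pose e := Num.min (1 / (2 * b)) (eps / (3 * K * b)).
have e0 : 0 < e by rewrite lt_min !divr_gt0 // ?mulr_gt0 // mulr_gt0.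
have eb : b * e <= 1 / 2.
  apply: (@le_trans _ _ (b * (1 / (2 * b)))); first by rewrite ler_pM2l // ge_min lexx.
  by have -> : b * (1 / (2 * b)) = 1 / 2 by field; rewrite gt_eqF.
have eK : 3 * K * b * e <= eps.
  have KB : 0 < 3 * K * b by rewrite mulr_gt0 // mulr_gt0.
  by rewrite mulrC -ler_pdivlMr // ge_min lexx orbT.
have [G G2 HG] := square_concentration n n.+1 EP d0 e0.
exists G => // g1 g2 D ups1 ups2 xi1 xi2 g1G g2G g12 u1 u2 x1 x2 xD D0 o1 o2 k.
have x1d j : 0 < xi1 j < d by have := x1 j; lra.
have x2d j : 0 < xi2 j < d by have := x2 j; lra.
have x1_0 j : 0 < xi1 j by case/andP: (x1d j).
have x2_0 j : 0 < xi2 j by case/andP: (x2d j).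
have conc1 := fun p => HG g1 xi1 p g1G x1d.
have conc2 := fun p => HG g2 xi2 p g2G x2d.
have g10 : 0 <= g1 by lra.
have g20 : 0 <= g2 by lra.
have g220 : 0 <= g2 - 2 by lra.
have g120 : 0 <= g1 - 2 by lra.
set v := ups1 k.
have vb : b - v <= b ^+ 2 * e by exact: (zeros_near_end g120 u1 x1d o1 conc1 k).
have vlt : 0 < v < b := u1.2 k.
have be : b ^+ 2 * e <= b / 2.
  have : b * (b * e) <= b * (1 / 2) by rewrite ler_pM2l.
  by rewrite mulrA -expr2; lra.
have [L1 [L1E L1ge L1gt]] := side_functional g10 x1_0.
have [L2 [L2E L2ge L2gt]] := side_functional g20 x2_0.
have orth1 : orthogonal_below L1 n (nodal ups1) by move=> g sg; rewrite L1E o1.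
have orth2 : orthogonal_below L2 n (nodal ups2) by move=> g sg; rewrite L2E o2.
pose q := interlacing_test ups1 ups2 k.
have q0 : q != 0 by exact: interlacing_test_neq0.
have sq : size q = n by exact: size_interlacing_test.
have I1 : L1 (('X - v%:P) * q ^+ 2) <= 0 by exact: interlacing_test_le0 u1.1 orth1 L1ge.
have I2 : 0 <= L2 (('X - (ups2 k)%:P) * q ^+ 2).
  exact: interlacing_test_ge0 u2.1 orth2 L2ge.
(* With this scaling the difference of the weights vanishes at [v]; as the first integral is
   nonpositive, subtracting [c] times it can only enlarge the bound in [P1]. *)
pose c := side_weight xi2 g2 v / side_weight xi1 g1 v.
have c0 : 0 <= c by rewrite divr_ge0 // ltW // side_weight_gt0 //; case/andP: vlt.
have S0gt : 0 < L2 (q ^+ 2) by exact: L2gt.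
set S0 := L2 (q ^+ 2) in S0gt *.
set dD := `|g2 - g1| + D.
have dD0 : 0 <= dD by rewrite addr_ge0.
have P1 : (ups2 k - v) * S0 <= L2 (('X - v%:P) * q ^+ 2) - c * L1 (('X - v%:P) * q ^+ 2).
  have -> : (ups2 k - v) * S0 =
      L2 (('X - v%:P) * q ^+ 2) - L2 (('X - (ups2 k)%:P) * q ^+ 2).
    rewrite -linearB -linearZ; congr (L2 _).
    by rewrite -mul_polyC rmorphB /=; ring.
  have : c * L1 (('X - v%:P) * q ^+ 2) <= 0 by rewrite mulr_ge0_le0.
  by clear - I2; lra.
pose W2 := side_weight xi2 (g2 - 2).
have aw2 : admissible b W2 by exact: admissible_side_weight.
have aq : admissible b (fun u => q.[u] ^+ 2).
  by under eq_fun do rewrite -horner_exp; exact: admissible_horner.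
have abu : admissible b (fun u => b - u).
  have -> : (fun u => b - u) = (fun u => (b%:P - 'X).[u]).
    by apply/funext => u; rewrite !hornerE.
  exact: admissible_horner.
have aZ a f : admissible b f -> admissible b (fun u => a * f u).
  by move=> af; apply: admissibleM => //; exact: admissible_cst.
pose T := E (fun u => (b - u) * q.[u] ^+ 2 * W2 u).
pose S2 := E (fun u => q.[u] ^+ 2 * W2 u).
have aT : admissible b (fun u => (b - u) * q.[u] ^+ 2 * W2 u).
  by do 2! apply: admissibleM => //.
have aS2 : admissible b (fun u => q.[u] ^+ 2 * W2 u) by exact: admissibleM.
have W20 u : u \in `]0, b[ -> 0 <= W2 u.
  by rewrite in_itv/= => /andP[u0 _]; rewrite ltW // side_weight_gt0.
have S0E : S0 = E (fun u => q.[u] ^+ 2 * side_weight xi2 g2 u).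
  by rewrite /S0 L2E; under eq_fun do rewrite horner_exp.
have TS : T <= e * S0 by rewrite S0E; apply: conc2; rewrite sq.
(* This returns from the exponent g2 - 2 to g2 without dividing by u, through 1 <= (u/b)^2 + 2 (b -
   u)/b, whose defect is ((b - u)/b)^2. *)
have S2S : S2 <= (b ^+ 2)^-1 * S0 + 2 / b * T.
  rewrite S0E -!(functionalZ EP) //; last first.
    by apply: admissibleM => //; exact: admissible_side_weight.
  rewrite -(functionalD EP) //; [|apply: (aZ); apply: admissibleM => //; exact: admissible_side_weight|exact: aZ].
  apply: (functional_le EP) => //.
    apply: admissibleD; last exact: aZ.
    by apply: (aZ); apply: admissibleM => //; exact: admissible_side_weight.
  move=> u ub; have [u0 ub'] : 0 < u /\ u < b by move: ub; rewrite in_itv/= => /andP[].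
  have -> : side_weight xi2 g2 u = u ^+ 2 * W2 u.
    rewrite /W2 /side_weight powRB ?(gt_eqF u0) ?implybT // -[2]/(2%:R).
    rewrite powR_mulrn ?(ltW u0) //; field; rewrite gt_eqF //.
  have -> : (b ^+ 2)^-1 * (q.[u] ^+ 2 * (u ^+ 2 * W2 u))
      + 2 / b * ((b - u) * q.[u] ^+ 2 * W2 u) =
    q.[u] ^+ 2 * W2 u + ((b - u) / b) ^+ 2 * (q.[u] ^+ 2 * W2 u).
    by field; rewrite gt_eqF.
  by rewrite lerDl mulr_ge0 ?sqr_ge0 // mulr_ge0 ?sqr_ge0 // W20.
(* The integrand carries |u - v|^2, bounded by b ((b - u) + (b - v)): one term is handled by
   concentration, the other by the position of [v] near [b]. *)
have P2 : L2 (('X - v%:P) * q ^+ 2) - c * L1 (('X - v%:P) * q ^+ 2) <=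
    K * dD * b * (T + (b - v) * S2).
  have a1 := admissible_side_weight b xi1 g10.
  have a2 := admissible_side_weight b xi2 g20.
  have ah p : admissible b (fun u => p.[u]) by exact: admissible_horner.
  have apw p w : admissible b w -> admissible b (fun u => p.[u] * w u).
    by move=> aw; apply: admissibleM.
  have -> : L2 (('X - v%:P) * q ^+ 2) - c * L1 (('X - v%:P) * q ^+ 2) =
      E (fun u => (('X - v%:P) * q ^+ 2).[u] * side_weight xi2 g2 u
        + - c * ((('X - v%:P) * q ^+ 2).[u] * side_weight xi1 g1 u)).
    rewrite (functionalD EP) ?(functionalZ EP) -?L1E -?L2E ?mulNr //; try exact: apw.
    by apply: (aZ); exact: apw.
  have -> : K * dD * b * (T + (b - v) * S2) =
      E (fun u => K * dD * b * ((b - u) * q.[u] ^+ 2 * W2 u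
        + (b - v) * (q.[u] ^+ 2 * W2 u))).
    rewrite (functionalZ EP); last by apply: admissibleD => //; exact: aZ.
    by rewrite (functionalD EP) ?(functionalZ EP) //; exact: aZ.
  apply: (functional_le EP).
  - by apply: admissibleD; [|apply: (aZ)]; exact: apw.
  - by apply: (aZ); apply: admissibleD => //; exact: aZ.
  move=> u ub; have [u0 ub'] : 0 < u /\ u < b by move: ub; rewrite in_itv/= => /andP[].
  have qE : (('X - v%:P) * q ^+ 2).[u] = (u - v) * q.[u] ^+ 2 by rewrite !hornerE.
  rewrite qE.
  have -> : (u - v) * q.[u] ^+ 2 * side_weight xi2 g2 u
      + - c * ((u - v) * q.[u] ^+ 2 * side_weight xi1 g1 u) =
    q.[u] ^+ 2 * ((u - v) * (side_weight xi2 g2 u - c * side_weight xi1 g1 u)) by ring.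
  have -> : K * dD * b * ((b - u) * q.[u] ^+ 2 * W2 u + (b - v) * (q.[u] ^+ 2 * W2 u)) =
    q.[u] ^+ 2 * (b * ((b - u) + (b - v)) * (K * dD * W2 u)) by ring.
  rewrite ler_wpM2l ?sqr_ge0 //; apply: (le_trans (ler_norm _)); rewrite normrM.
  have x1' j : d / 2 <= xi1 j <= d by case/andP: (x1 j) => -> /ltW.
  have x2' j : d / 2 <= xi2 j <= d by case/andP: (x2 j) => -> /ltW.
  have bv : b / 2 <= v by clear - vb be; lra.
  have vb' : v <= b by case/andP: vlt => _ /ltW.
  have := HK xi1 xi2 D g1 g2 u v x1' x2' xD D0 g12 u0 ub' bv vb'.
  rewrite -/c -/dD => hK.
  have KW0 : 0 <= K * dD * W2 u by rewrite mulr_ge0 ?W20 // mulr_ge0 // ltW.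
  apply: (@le_trans _ _ (`|u - v| * (`|u - v| * (K * dD * W2 u)))).
    by rewrite ler_wpM2l //; apply: (le_trans hK);
       rewrite -/(W2 u) [leRHS]mulrCA [leRHS]mulrA.
  rewrite mulrA ler_wpM2r //; apply: ler_pM => //.
    by rewrite ler_norml; clear - vlt u0 ub'; lra.
  by rewrite ler_norml; clear - vlt u0 ub'; lra.
have T0 : 0 <= T.
  apply: (functional_ge0 EP) => u ub; rewrite mulr_ge0 ?W20 // mulr_ge0 ?sqr_ge0 //.
  by move: ub; rewrite in_itv/= subr_ge0 => /andP[_ /ltW].
have S20 : 0 <= S2.
  by apply: (functional_ge0 EP) => u ub; rewrite mulr_ge0 ?W20 // sqr_ge0.
(* [T] contributes e S0, and (b - v) S2 at most e S0 + 2 (b e) e S0, which is at most 2 e S0 because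
   b e <= 1/2. *)
have P3 : T + (b - v) * S2 <= 3 * e * S0.
  have h1 : (b - v) * S2 <= b ^+ 2 * e * S2 by rewrite ler_wpM2r.
  have h2 : b ^+ 2 * e * S2 <= b ^+ 2 * e * ((b ^+ 2)^-1 * S0 + 2 / b * (e * S0)).
    apply: ler_wpM2l; first by rewrite mulr_ge0 ?sqr_ge0 // ltW.
    apply: (le_trans S2S).
    by rewrite lerD2l ler_wpM2l // divr_ge0 // ltW.
  have h3 : b ^+ 2 * e * ((b ^+ 2)^-1 * S0 + 2 / b * (e * S0)) =
      e * S0 + 2 * (b * e) * (e * S0) by field; rewrite gt_eqF.
  have h4 : (b * e) * (e * S0) <= 1 / 2 * (e * S0).
    by rewrite ler_wpM2r // mulr_ge0 // ltW.
  by clear - TS h1 h2 h3 h4; lra.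
have P4 : (ups2 k - v) * S0 <= eps * dD * S0.
  apply: (le_trans P1); apply: (le_trans P2).
  apply: (@le_trans _ _ (K * dD * b * (3 * e * S0))).
    by rewrite ler_wpM2l // mulr_ge0 ?(ltW b0) // mulr_ge0 // ltW.
  have -> : K * dD * b * (3 * e * S0) = (3 * K * b * e) * (dD * S0) by ring.
  by rewrite -[leRHS]mulrA ler_wpM2r // mulr_ge0 // ltW.
by move: P4; rewrite ler_pM2r.
Qed.

(** The power contributes exp((gamma2 - gamma1) l) with l = ln(v/u), while each factor u + xi_j can
    lose at most exp((2/d) |xi2_j - xi1_j| l), since (v - u)/v <= l and xi1_j >= d/2. The smallness
    hypothesis says that the gain wins. *)
Lemma side_weight_ratio_increasing (gamma1 gamma2 : R) (xi1 xi2 : 'I_n -> R)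
    (u v : R) :
  (forall j, d / 2 <= xi1 j) -> (forall j, 0 < xi2 j) ->
  2 / d * \sum_(j < n) `|xi2 j - xi1 j| < gamma2 - gamma1 ->
  0 < u -> u < v ->
  side_weight xi2 gamma2 u * side_weight xi1 gamma1 v <
  side_weight xi2 gamma2 v * side_weight xi1 gamma1 u.
Proof.
move=> x1 x2 small u0 uv; have v0 : 0 < v by exact: lt_trans uv.
have x1_0 j : 0 < xi1 j by apply: lt_le_trans (x1 j); rewrite divr_gt0.
pose l := ln (v / u).
have l1 : (v - u) / v <= l.
  have -> : (v - u) / v = 1 - u / v by field; rewrite gt_eqF.
  exact: ln_ge_sub.
have l0 : 0 < l by apply: lt_le_trans l1; rewrite divr_gt0 // subr_gt0.
have P (x : 'I_n -> R) z : (forall j, 0 < x j) -> 0 < z ->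
    0 < \prod_(i < n) (z - - x i).
  by move=> x0 z0; apply: prodr_gt0 => i _; rewrite opprK addr_gt0.
have P1v := P _ _ x1_0 v0; have P2u := P _ _ x2 u0.
have P1u := P _ _ x1_0 u0; have P2v := P _ _ x2 v0.
have prodle : \prod_(i < n) (u - - xi2 i) * \prod_(i < n) (v - - xi1 i) <=
    expR (2 / d * (\sum_(j < n) `|xi2 j - xi1 j|) * l) *
    (\prod_(i < n) (v - - xi2 i) * \prod_(i < n) (u - - xi1 i)).
  clear small; rewrite mulr_sumr mulr_suml expR_sum -!big_split /=.
  apply: ler_prod => j _; rewrite !opprK.
  have a1 : 0 < u + xi1 j by rewrite addr_gt0.
  have a2 : 0 < v + xi2 j by rewrite addr_gt0.
  have a3 : 0 < u + xi2 j by rewrite addr_gt0.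
  have a4 : 0 < v + xi1 j by rewrite addr_gt0.
  apply/andP; split; first by rewrite mulr_ge0 ?ltW.
  have a12 := mulr_gt0 a2 a1.
  rewrite -ler_pdivrMr //.
  have -> : (u + xi2 j) * (v + xi1 j) / ((v + xi2 j) * (u + xi1 j)) =
     1 + (v - u) * (xi2 j - xi1 j) / ((v + xi2 j) * (u + xi1 j)).
    by field; rewrite !gt_eqF.
  apply: (le_trans _ (expR_ge1Dx _)); rewrite lerD2l.
  apply: (@le_trans _ _ (2 / d * `|xi2 j - xi1 j| * ((v - u) / v))); last first.
    by rewrite ler_wpM2l // mulr_ge0 // divr_ge0 // ltW.
  apply: (@le_trans _ _ ((v - u) * `|xi2 j - xi1 j| / ((v + xi2 j) * (u + xi1 j)))).
    rewrite ler_wpM2r ?invr_ge0 ?(ltW a12) // ler_wpM2l ?ler_norm //; lra.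
  have -> : 2 / d * `|xi2 j - xi1 j| * ((v - u) / v) =
     (v - u) * `|xi2 j - xi1 j| / (v * (d / 2)) by field; rewrite !gt_eqF.
  rewrite ler_wpM2l ?mulr_ge0 // ?subr_ge0 ?(ltW uv) //.
  rewrite lef_pV2 ?posrE ?mulr_gt0 ?divr_gt0 //.
  have := x1 j; have := x2 j => h2 h1.
  by apply: ler_pM; rewrite ?divr_ge0 ?(ltW d0) //; lra.
have powE : v `^ gamma2 * u `^ gamma1 =
    expR ((gamma2 - gamma1) * l) * (u `^ gamma2 * v `^ gamma1).
  have -> : expR ((gamma2 - gamma1) * l) = (v / u) `^ (gamma2 - gamma1).
    by rewrite /powR gt_eqF // divr_gt0.
  rewrite powR_div // !powRB ?(gt_eqF u0) ?(gt_eqF v0) ?implybT //.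
  by field; rewrite !gt_eqF ?powR_gt0.
rewrite /side_weight !horner_nodal.
have -> : \prod_(i < n) (v - - xi2 i) * v `^ gamma2 *
    (\prod_(i < n) (u - - xi1 i) * u `^ gamma1) =
  expR ((gamma2 - gamma1) * l) *
    (\prod_(i < n) (v - - xi2 i) * \prod_(i < n) (u - - xi1 i)) *
    (u `^ gamma2 * v `^ gamma1).
  rewrite mulrACA powE; ring.
rewrite mulrACA ltr_pM2r ?mulr_gt0 ?powR_gt0 //.
apply: (le_lt_trans prodle); rewrite ltr_pM2r ?mulr_gt0 //.
by rewrite ltr_expR ltr_pM2r.
Qed.

Lemma zeros_strictly_increase (gamma1 gamma2 : R)
    (ups1 ups2 xi1 xi2 : 'I_n -> R) :
  0 <= gamma1 -> 0 <= gamma2 ->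
  ordered_in b ups1 -> ordered_in b ups2 ->
  (forall j, d / 2 <= xi1 j) -> (forall j, 0 < xi2 j) ->
  2 / d * \sum_(j < n) `|xi2 j - xi1 j| < gamma2 - gamma1 ->
  side_orthogonal E gamma1 ups1 xi1 -> side_orthogonal E gamma2 ups2 xi2 ->
  forall k, ups1 k < ups2 k.
Proof.
move=> g1 g2 u1 u2 x1 x2 small o1 o2 k.
have x1_0 j : 0 < xi1 j by apply: lt_le_trans (x1 j); rewrite divr_gt0.
have [L1 [L1E L1ge L1gt]] := side_functional g1 x1_0.
have [L2 [L2E L2ge L2gt]] := side_functional g2 x2.
have orth1 : orthogonal_below L1 n (nodal ups1) by move=> g sg; rewrite L1E o1.
have orth2 : orthogonal_below L2 n (nodal ups2) by move=> g sg; rewrite L2E o2.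
(* The roles are reversed with respect to the Lipschitz estimate: if v = ups2_k did not exceed
   ups1_k, the second integral of (u - v) q^2 would be nonpositive and the first nonnegative,
   against the strict growth of the ratio of the weights. *)
pose q := interlacing_test ups2 ups1 k; set v := ups2 k.
have q0 : q != 0 by exact: interlacing_test_neq0.
have I2 : L2 (('X - v%:P) * q ^+ 2) <= 0 by exact: interlacing_test_le0 u2.1 orth2 L2ge.
have I1 : 0 <= L1 (('X - (ups1 k)%:P) * q ^+ 2).
  exact: interlacing_test_ge0 u1.1 orth1 L1ge.
rewrite ltNge; apply/negP => vle.
have I1v : 0 <= L1 (('X - v%:P) * q ^+ 2).
  have -> : ('X - v%:P) * q ^+ 2 =
      ('X - (ups1 k)%:P) * q ^+ 2 + (ups1 k - v) *: q ^+ 2.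
    by rewrite -mul_polyC rmorphB /=; ring.
  by rewrite linearD linearZ addr_ge0 //= mulr_ge0 // subr_ge0.
have /andP[v0 vb] := u2.2 k; rewrite -/v in v0 vb.
have w1v := side_weight_gt0 gamma1 x1_0 v0.
have w2v := side_weight_gt0 gamma2 x2 v0.
pose c := side_weight xi2 gamma2 v / side_weight xi1 gamma1 v.
have c0 : 0 < c by rewrite divr_gt0.
have : 0 < L2 (('X - v%:P) * q ^+ 2) - c * L1 (('X - v%:P) * q ^+ 2); last first.
  have : 0 <= c * L1 (('X - v%:P) * q ^+ 2) by rewrite mulr_ge0 // ltW.
  lra.
have a1 := admissible_side_weight b xi1 g1.
have a2 := admissible_side_weight b xi2 g2.
have ah p : admissible b (fun u => p.[u]) by exact: admissible_horner.
have aZ a f : admissible b f -> admissible b (fun u => a * f u).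
  by move=> af; apply: admissibleM => //; exact: admissible_cst.
rewrite L1E L2E -mulNr -(functionalZ EP); last exact: admissibleM.
rewrite -(functionalD EP); [|exact: admissibleM|by apply: (aZ); exact: admissibleM].
have qE u : (('X - v%:P) * q ^+ 2).[u] * side_weight xi2 gamma2 u
    + - c * ((('X - v%:P) * q ^+ 2).[u] * side_weight xi1 gamma1 u) =
  q.[u] ^+ 2 * ((u - v) * (side_weight xi2 gamma2 u - c * side_weight xi1 gamma1 u)).
  have -> : (('X - v%:P) * q ^+ 2).[u] = (u - v) * q.[u] ^+ 2 by rewrite !hornerE.
  ring.
have pos u : u \in `]0, b[ -> u != v ->
    0 < (u - v) * (side_weight xi2 gamma2 u - c * side_weight xi1 gamma1 u).
  rewrite in_itv/= => /andP[u0 ub]; rewrite neq_lt => /orP[uv|vu].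
    rewrite nmulr_rgt0 ?subr_lt0 // /c mulrAC ltr_pdivlMr //.
    exact: side_weight_ratio_increasing.
  rewrite pmulr_rgt0 ?subr_gt0 // /c mulrAC ltr_pdivrMr //.
  exact: side_weight_ratio_increasing.
have p0 : ('X - v%:P) * q != 0 by rewrite mulf_neq0 // polyXsubC_eq0.
apply: (functional_gt0 (c := 0) EP _ p0).
- by apply: admissibleD; [|apply: (aZ)]; exact: admissibleM.
- by rewrite lexx b0.
- move=> u ub; rewrite qE mulr_ge0 ?sqr_ge0 //.
  have [->|uv] := eqVneq u v; first by rewrite subrr mul0r.
  by rewrite ltW // pos.
- move=> u ub; rewrite rootM root_XsubC negb_or => /andP[uv qu].
  by rewrite qE mulr_gt0 ?pos // exprn_even_gt0.
Qed.

End OneSide.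

(** * Coupling of the two intervals *)

Lemma coupled_zeros_increase (R : realType) (b d : R) (E E' : (R -> R) -> R)
    (n : nat) :
  positive_functional b E -> positive_functional d E' ->
  exists2 G : R, 2 <= G & forall (gamma1 gamma2 : R) (ups1 ups2 xi1 xi2 : 'I_n -> R),
    G <= gamma1 -> gamma1 < gamma2 <= gamma1 + 1 ->
    ordered_in b ups1 -> ordered_in d xi1 ->
    ordered_in b ups2 -> ordered_in d xi2 ->
    side_orthogonal E gamma1 ups1 xi1 -> side_orthogonal E' gamma1 xi1 ups1 ->
    side_orthogonal E gamma2 ups2 xi2 -> side_orthogonal E' gamma2 xi2 ups2 ->
    forall k, ups1 k < ups2 k /\ xi1 k < xi2 k.
Proof.
move=> EP EP'; have b0 := functional_dom EP; have d0 := functional_dom EP'.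
(* With delta = g2 - g1, adding D <= m (delta + D') and D' <= m (delta + D) gives D + D' <= 4 m
   delta, as m <= 1/2 absorbs the right side. The sixteenths then make (2/b) D and (2/d) D' at most
   delta/2. *)
pose m := Num.min (1 / 2) (Num.min (b / 16) (d / 16)).
have m0 : 0 < m by rewrite !lt_min !divr_gt0.
have m2 : m <= 1 / 2 by rewrite ge_min lexx.
have mb : m <= b / 16 by rewrite !ge_min lexx orbT.
have md : m <= d / 16 by rewrite !ge_min lexx !orbT.
(* The Lipschitz bound holds zero by zero, whereas [D] and [D'] sum over n zeros. *)
have [e e0 ne] : exists2 e : R, 0 < e & n%:R * e <= m.
  exists (m / n.+1%:R); first by rewrite divr_gt0.
  by rewrite mulrCA ler_piMr ?(ltW m0) // ler_pdivrMr // mul1r ler_nat.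
have [G1 G1_2 HG1] := zeros_one_sided_lipschitz n EP d0 e0.
have [G2 G2_2 HG2] := zeros_one_sided_lipschitz n EP' b0 e0.
have b20 : 0 < b / 2 by rewrite divr_gt0.
have d20 : 0 < d / 2 by rewrite divr_gt0.
have [G3 G3_2 HG3] := zeros_eventually_near_end n EP d0 b20.
have [G4 G4_2 HG4] := zeros_eventually_near_end n EP' b0 d20.
exists (Num.max (Num.max G1 G2) (Num.max G3 G4)); first by rewrite !le_max G1_2.
move=> g1 g2 ups1 ups2 xi1 xi2; rewrite !ge_max => /andP[/andP[gG1 gG2] /andP[gG3 gG4]].
move=> /andP[g12 g21] u1 x1 u2 x2 o1 o1' o2 o2' k.
have u1b i : b / 2 <= ups1 i < b.
  have := HG3 g1 ups1 xi1 gG3 u1 x1.2 o1 i; have := u1.2 i; lra.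
have g2G3 : G3 <= g2 by lra.
have g2G4 : G4 <= g2 by lra.
have g2G1 : G1 <= g2 by lra.
have g2G2 : G2 <= g2 by lra.
have u2b i : b / 2 <= ups2 i < b.
  have := HG3 g2 ups2 xi2 g2G3 u2 x2.2 o2 i; have := u2.2 i; lra.
have x1d i : d / 2 <= xi1 i < d.
  have := HG4 g1 xi1 ups1 gG4 x1 u1.2 o1' i; have := x1.2 i; lra.
have x2d i : d / 2 <= xi2 i < d.
  have := HG4 g2 xi2 ups2 g2G4 x2 u2.2 o2' i; have := x2.2 i; lra.
pose D := \sum_(i < n) `|ups2 i - ups1 i|.
pose D' := \sum_(i < n) `|xi2 i - xi1 i|.
have D0 : 0 <= D by exact: sumr_ge0.
have D'0 : 0 <= D' by exact: sumr_ge0.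
have le_sum (f : 'I_n -> R) i : `|f i| <= \sum_(j < n) `|f j|.
  by rewrite (bigD1 i) //= lerDl sumr_ge0.
have dD i : `|ups2 i - ups1 i| <= D by exact: (le_sum (fun j => ups2 j - ups1 j)).
have dD' i : `|xi2 i - xi1 i| <= D' by exact: (le_sum (fun j => xi2 j - xi1 j)).
have dDs i : `|ups1 i - ups2 i| <= D by rewrite distrC.
have dDs' i : `|xi1 i - xi2 i| <= D' by rewrite distrC.
have dg : `|g2 - g1| = g2 - g1 by rewrite ger0_norm // subr_ge0 ltW.
have dgs : `|g1 - g2| = g2 - g1 by rewrite distrC.
have d1 : `|g2 - g1| <= 1 by rewrite dg; clear - g21; lra.
have d1s : `|g1 - g2| <= 1 by rewrite dgs; clear - g21; lra.
have sum_le (f : 'I_n -> R) (X : R) : 0 <= X ->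
    (forall i, `|f i| <= e * X) -> \sum_(i < n) `|f i| <= m * X.
  move=> X0 fX; apply: (@le_trans _ _ (\sum_(i < n) (e * X))); first exact: ler_sum.
  by rewrite sumr_const card_ord -[leLHS]mulr_natl mulrA ler_wpM2r.
(* The lower half of each absolute value is the one-sided bound with the two states exchanged. *)
have DD' : D <= m * (g2 - g1 + D').
  apply: sum_le => [|i]; first by rewrite addr_ge0 // subr_ge0 ltW.
  rewrite ler_norml; apply/andP; split.
    have := HG1 g2 g1 D' ups2 ups1 xi2 xi1 g2G1 gG1 d1s u2 u1 x2d x1d dDs' D'0 o2 o1 i.
    by rewrite dgs; clear; lra.
  have := HG1 g1 g2 D' ups1 ups2 xi1 xi2 gG1 g2G1 d1 u1 u2 x1d x2d dD' D'0 o1 o2 i.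
  by rewrite dg.
have D'D : D' <= m * (g2 - g1 + D).
  apply: sum_le => [|i]; first by rewrite addr_ge0 // subr_ge0 ltW.
  rewrite ler_norml; apply/andP; split.
    have := HG2 g2 g1 D xi2 xi1 ups2 ups1 g2G2 gG2 d1s x2 x1 u2b u1b dDs D0 o2' o1' i.
    by rewrite dgs; clear; lra.
  have := HG2 g1 g2 D xi1 xi2 ups1 ups2 gG2 g2G2 d1 x1 x2 u1b u2b dD D0 o1' o2' i.
  by rewrite dg.
have dpos : 0 < g2 - g1 by rewrite subr_gt0.
have DD : D + D' <= 4 * (m * (g2 - g1)).
  have : m * (D + D') <= 1 / 2 * (D + D') by rewrite ler_wpM2r // addr_ge0.
  by clear - DD' D'D; lra.
have sb : 2 / b * D < g2 - g1.
  have h : m * (g2 - g1) <= b / 16 * (g2 - g1) by rewrite ler_pM2r.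
  rewrite mulrAC ltr_pdivrMr // [ltRHS]mulrC.
  have : 0 < b * (g2 - g1) by rewrite mulr_gt0.
  by clear - DD D0 D'0 h; lra.
have sd : 2 / d * D' < g2 - g1.
  have h : m * (g2 - g1) <= d / 16 * (g2 - g1) by rewrite ler_pM2r.
  rewrite mulrAC ltr_pdivrMr // [ltRHS]mulrC.
  have : 0 < d * (g2 - g1) by rewrite mulr_gt0.
  by clear - DD D0 D'0 h; lra.
have g10 : 0 <= g1 by clear - gG1 G1_2; lra.
have g20 : 0 <= g2 by clear - g10 g12; lra.
split.
- apply: (zeros_strictly_increase EP d0 g10 g20 u1 u2 _ _ sd o1 o2 k) => j.
    by case/andP: (x1d j).
  by case/andP: (x2.2 j).
- apply: (zeros_strictly_increase EP' b0 g10 g20 x1 x2 _ _ sb o1' o2' k) => j.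
    by case/andP: (u1b j).
  by case/andP: (u2.2 j).
Qed.

(** * Existence of the Angelesco-Jacobi polynomials and location of their zeros *)

Section AngelescoJacobi.
Variables (R : realType) (alpha beta a : R).
Hypotheses (halpha : -1 < alpha) (hbeta : -1 < beta) (ha : a < 0).

Let w := jacobi_weight alpha beta a.
Definition neg_integral : (R -> R) -> R := abs_integral `]a, 0[ w.
Definition pos_integral : (R -> R) -> R := abs_integral `]0, 1[ w.

Lemma neg_integral_positive : positive_functional (- a) neg_integral.
Proof.
apply: (@abs_integral_positive _ a 0 (-1) (- a)).
- by rewrite oppr_eq0 oner_eq0.
- by rewrite oppr_gt0.
- move=> x; rewrite in_itv/= => /andP[ax x0].
  by rewrite ltr0_norm // mulN1r; split=> //; rewrite oppr_gt0 x0 ltrN2 ax.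
- move=> c /andP[c0 ca]; exists a, (- c); split; first by rewrite ltrNr.
    move=> x; rewrite !in_itv/= => /andP[-> xc] /=.
    by apply: lt_le_trans xc _; rewrite oppr_le0.
  move=> x; rewrite in_itv/= => /andP[ax xc].
  by rewrite lter_normr [X in _ || X]ltrNr xc orbT.
- move=> x; rewrite in_itv/= => /andP[ax x0].
  by rewrite mulr_gt0 // powR_gt0 // subr_gt0 // (lt_trans x0).
- exact: integrable_jacobi_weight_neg.
Qed.

Lemma pos_integral_positive : positive_functional 1 pos_integral.
Proof.
apply: (@abs_integral_positive _ 0 1 1 1).
- exact: oner_neq0.
- exact: ltr01.
- move=> x; rewrite in_itv/= => /andP[x0 x1].
  by rewrite gtr0_norm // mul1r x0 x1.
- move=> c /andP[c0 ca]; exists c, 1; split => //.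
    move=> x; rewrite !in_itv/= => /andP[cx ->]; rewrite andbT.
    exact: le_lt_trans cx.
  move=> x; rewrite in_itv/= => /andP[cx _].
  by rewrite lter_normr cx.
- move=> x; rewrite in_itv/= => /andP[ax x0].
  by rewrite mulr_gt0 // powR_gt0 // subr_gt0 // (lt_trans ha).
- exact: integrable_jacobi_weight_pos.
Qed.

Definition reflect_poly (p : {poly R}) : {poly R} := p \Po (- 'X).

Lemma horner_reflect p u : (reflect_poly p).[u] = p.[- u].
Proof. by rewrite /reflect_poly horner_comp !hornerE. Qed.

Lemma reflectK : involutive reflect_poly.
Proof.
move=> p; rewrite /reflect_poly -comp_polyA.
have -> : (- 'X) \Po (- 'X) = 'X :> {poly R} by rewrite rmorphN /= comp_polyX opprK.
by rewrite comp_polyXr.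
Qed.

Lemma reflectM p q : reflect_poly (p * q) = reflect_poly p * reflect_poly q.
Proof. exact: rmorphM. Qed.

Lemma size_reflect p : size (reflect_poly p) = size p.
Proof. by rewrite size_comp_poly2 // size_polyN size_polyX. Qed.

Definition neg_moment (gamma : R) (p : {poly R}) : R :=
  neg_integral (fun u => (reflect_poly p).[u] * u `^ gamma).
Definition pos_moment (gamma : R) (p : {poly R}) : R :=
  pos_integral (fun u => p.[u] * u `^ gamma).

Lemma neg_momentE gamma (k : nat) (p : {poly R}) :
  \int[lebesgue_measure]_(x in `]a, 0[)
    (x ^+ k * p.[x] * (1 - x) `^ alpha * (x - a) `^ beta * `|x| `^ gamma) =
  neg_moment gamma (p * 'X^k).
Proof.
apply: eq_Rintegral => x; rewrite inE/= in_itv/= => /andP[_ x0].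
rewrite horner_reflect ltr0_norm // opprK hornerM hornerXn /w /jacobi_weight; ring.
Qed.

Lemma pos_momentE gamma (k : nat) (p : {poly R}) :
  \int[lebesgue_measure]_(x in `]0, 1[)
    (x ^+ k * p.[x] * (1 - x) `^ alpha * (x - a) `^ beta * x `^ gamma) =
  pos_moment gamma (p * 'X^k).
Proof.
apply: eq_Rintegral => x; rewrite inE/= in_itv/= => /andP[x0 _].
rewrite gtr0_norm // hornerM hornerXn /w /jacobi_weight; ring.
Qed.

Lemma moment_scalar gamma : 0 <= gamma ->
  scalar (neg_moment gamma) /\ scalar (pos_moment gamma).
Proof.
move=> g0; have [L LE] := poly_functional neg_integral_positive (admissible_powR (- a) g0).
have [L' LE'] := poly_functional pos_integral_positive (admissible_powR 1 g0).
split=> c p q; last by rewrite /pos_moment -!LE' linearP.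
rewrite /neg_moment -!LE -linearP; congr (L _).
by rewrite /reflect_poly linearP.
Qed.

Lemma moment_orthogonal (M : {poly R} -> R) (n : nat) (p : {poly R}) :
  scalar M -> (forall k, (k < n)%N -> M (p * 'X^k) = 0) -> orthogonal_below M n p.
Proof.
move=> sM Mk g sg.
pose L : {scalar {poly R}} := HB.pack M (GRing.isLinear.Build _ _ _ _ _ sM).
rewrite -[M _]/(L _) -(coefK g) poly_def mulr_sumr linear_sum big1 // => i _.
rewrite -scalerAr.
have -> : L (g`_i *: (p * 'X^i)) = g`_i * M (p * 'X^i) by exact: linearZ.
by rewrite Mk ?mulr0 // (leq_trans (ltn_ord i)).
Qed.

(** This serves twice: for a polynomial of degree below 2n the 2n roots are too many, which makes
    the moment system injective; for degree 2n they are all the zeros. *)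
Lemma moments_roots gamma (n : nat) (p : {poly R}) : 0 <= gamma -> p != 0 ->
  (forall k, (k < n)%N -> neg_moment gamma (p * 'X^k) = 0) ->
  (forall k, (k < n)%N -> pos_moment gamma (p * 'X^k) = 0) ->
  exists s t : seq R, [/\ uniq (s ++ t), {subset s <= `]a, 0[},
    {subset t <= `]0, 1[}, all (root p) (s ++ t) & (n <= size s)%N /\ (n <= size t)%N].
Proof.
move=> g0 p0 Mn Mp; have [sn sp] := moment_scalar g0.
have On := moment_orthogonal sn Mn; have Op := moment_orthogonal sp Mp.
have w0 b : {in `]0, b[, forall u : R, 0 < u `^ gamma}.
  by move=> u; rewrite in_itv/= => /andP[u0 _]; rewrite powR_gt0.
have rp0 : reflect_poly p != 0 by rewrite -size_poly_eq0 size_reflect size_poly_eq0.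
have [s [us sb sr sn']] : exists s : seq R, [/\ uniq s, {subset s <= `]0, - a[},
    {subset s <= root (reflect_poly p)} & (n <= size s)%N].
  apply: (orthogonal_many_roots neg_integral_positive (admissible_powR _ g0)) => //.
  move=> g sg; rewrite -[g]reflectK -reflectM.
  by apply: On; rewrite size_reflect.
have [t [ut tb tr tn]] : exists s : seq R, [/\ uniq s, {subset s <= `]0, 1[},
    {subset s <= root p} & (n <= size s)%N].
  exact: (orthogonal_many_roots pos_integral_positive (admissible_powR _ g0)).
exists (map -%R s), t; split => //; last by rewrite size_map.
- rewrite cat_uniq (map_inj_uniq oppr_inj) us ut andbT /=; apply/hasPn => x /tb.
  rewrite in_itv/= => /andP[x0 _]; apply/negP => /mapP[y /sb].
  by rewrite in_itv/= => /andP[y0 _] xy; move: x0; rewrite xy oppr_gt0 ltNge ltW.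
- move=> _ /mapP[y /sb + ->]; rewrite !in_itv/= => /andP[y0 ya].
  by rewrite ltrNr ya oppr_lt0 y0.
- rewrite all_cat; apply/andP; split; last by apply/allP => x /tr.
  apply/allP => _ /mapP[y /sr + ->].
  by rewrite -topredE /= !rootE horner_reflect.
Qed.

Lemma angelesco_jacobi_exists gamma (n : nat) : 0 <= gamma ->
  exists p, is_angelesco_jacobi alpha beta gamma a n p.
Proof.
move=> g0; have [sn sp] := moment_scalar g0.
(* The first n functionals are the moments on ]a, 0[, the last n those on ]0, 1[, whose exponent is
   shifted back by n. *)
pose l (i : 'I_(2 * n)) (p : {poly R}) : R :=
  if (i < n)%N then neg_moment gamma (p * 'X^i)
  else pos_moment gamma (p * 'X^(i - n)).
have lsc i : scalar (l i).
  by move=> c p q; rewrite /l; case: ifP => _; rewrite mulrDl -scalerAl ?sn ?sp.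
have [|q sq lq] := @solve_functionals R (2 * n) l (fun i => - l i 'X^(2 * n)) lsc.
  move=> p ps lp; apply/eqP; case: eqVneq => // p0.
  have [||s [t [us _ _ rs [ns nt]]]] := @moments_roots gamma n p g0 p0.
  - move=> k kn; have k2 : (k < 2 * n)%N by rewrite mul2n -addnn ltn_addr.
    by have := lp (Ordinal k2); rewrite /l /= kn.
  - move=> k kn; have k2 : (n + k < 2 * n)%N by rewrite mul2n -addnn ltn_add2l.
    by have := lp (Ordinal k2); rewrite /l /= ltnNge leq_addr /= addKn.
  have := max_poly_roots p0 rs us.
  by rewrite ltnNge (leq_trans ps) // size_cat mul2n -addnn leq_add.
have sqX : (size q < size ('X^(2 * n) : {poly R}))%N by rewrite size_polyXn ltnS.
have lz i : l i ('X^(2 * n) + q) = 0.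
  by have := lsc i 1 'X^(2 * n) q; rewrite scale1r mul1r => ->; rewrite lq addrN.
exists ('X^(2 * n) + q); split.
- by rewrite monicE lead_coefDl // lead_coefXn.
- by rewrite size_polyDl // size_polyXn.
- move=> k kn; rewrite neg_momentE pos_momentE; split.
    have k2 : (k < 2 * n)%N by rewrite mul2n -addnn ltn_addr.
    by have := lz (Ordinal k2); rewrite /l /= kn.
  have k2 : (n + k < 2 * n)%N by rewrite mul2n -addnn ltn_add2l.
  by have := lz (Ordinal k2); rewrite /l /= ltnNge leq_addr /= addKn.
Qed.

End AngelescoJacobi.

(** Passing to |x| reverses the order on the negative side: the k-th smallest modulus, counted from
    0, belongs to the zero of index n - k counted from 1. On the positive side the index is n + k +
    1. *)
Lemma cat_nth_rev (R : realType) (n : nat) (s t : seq R) (k : 'I_n) :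
  size s = n ->
  (s ++ t)`_(n - k).-1 = (rev s)`_k /\ (s ++ t)`_(n + k) = t`_k.
Proof.
move=> ss; have kn := ltn_ord k; split.
  rewrite nth_cat ss nth_rev ss // subnS.
  by case: ltnP => //; rewrite leqNgt; lia.
by rewrite nth_cat ss ltnNge leq_addr /= addKn.
Qed.

Lemma prod_XsubC_seq (R : realType) (n : nat) (s : seq R) :
  size s = n -> \prod_(x <- s) ('X - x%:P) = nodal (fun i : 'I_n => s`_i).
Proof. by move=> ss; rewrite (big_nth 0) big_mkord ss. Qed.

Section Zeros.
Variables (R : realType) (alpha beta a gamma : R) (n : nat).
Hypotheses (halpha : -1 < alpha) (hbeta : -1 < beta) (ha : a < 0).
Hypothesis g0 : 0 <= gamma.

Let p := angelesco_jacobi alpha beta gamma a n.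

Lemma angelesco_jacobiP : is_angelesco_jacobi alpha beta gamma a n p.
Proof.
have [q pq] := angelesco_jacobi_exists halpha hbeta ha n g0.
exact: (@xgetPex _ 0 [set p | is_angelesco_jacobi alpha beta gamma a n p]
  (ex_intro _ q pq)).
Qed.

Lemma angelesco_jacobi_moments (k : nat) : (k < n)%N ->
  neg_moment alpha beta a gamma (p * 'X^k) = 0 /\
  pos_moment alpha beta a gamma (p * 'X^k) = 0.
Proof.
move=> kn; have [_ _ /(_ k kn)] := angelesco_jacobiP.
by rewrite neg_momentE pos_momentE.
Qed.

(** Each interval holds at least n roots and the degree allows 2n in all, so both counts are exact
    and all roots are simple. *)
Lemma angelesco_jacobi_roots : exists s t : seq R,
  [/\ rootsR p = s ++ t, sorted <%R s /\ sorted <%R t,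
      {subset s <= `]a, 0[} /\ {subset t <= `]0, 1[},
      size s = n /\ size t = n & p = \prod_(x <- s ++ t) ('X - x%:P)].
Proof.
have [mp sp _] := angelesco_jacobiP; have p0 : p != 0 by exact: monic_neq0.
have [||s [t [us sa tb rst [ns nt]]]] :=
  @moments_roots R alpha beta a halpha hbeta ha gamma n p g0 p0.
- by move=> k /angelesco_jacobi_moments[].
- by move=> k /angelesco_jacobi_moments[].
have st2n : (size s + size t <= 2 * n)%N.
  by have := max_poly_roots p0 rst us; rewrite sp size_cat ltnS.
have sn : size s = n by apply/eqP; rewrite eqn_leq ns andbT; lia.
have tn : size t = n by apply/eqP; rewrite eqn_leq nt andbT; lia.
have pE : p = \prod_(x <- s ++ t) ('X - x%:P).
  rewrite [LHS](all_roots_prod_XsubC _ rst) ?uniq_rootsE //.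
    by rewrite (monicP mp) scale1r.
  by rewrite sp size_cat sn tn mul2n addnn.
pose s' := sort <=%R s; pose t' := sort <=%R t.
have pst : perm_eq (s' ++ t') (s ++ t).
  by apply: perm_cat; rewrite perm_sort.
exists s', t'; move: us; rewrite cat_uniq => /and3P[us _ ut].
have ss' : sorted <%R s' by rewrite sort_lt_sorted.
have st' : sorted <%R t' by rewrite sort_lt_sorted.
have sa' : {subset s' <= `]a, 0[} by move=> x; rewrite mem_sort; exact: sa.
have tb' : {subset t' <= `]0, 1[} by move=> x; rewrite mem_sort; exact: tb.
split=> //; last by rewrite pE; apply: perm_big; rewrite perm_sym.
  apply: (irr_sorted_eq lt_trans (@ltxx _ _)).
  - exact: sorted_roots.
  - rewrite (sorted_pairwise lt_trans) pairwise_cat -!(sorted_pairwise lt_trans).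
    rewrite ss' st' !andbT; apply/allrelP => x y /sa' + /tb'.
    by rewrite !in_itv/= => /andP[_ x0] /andP[y0 _]; exact: lt_trans y0.
  - move=> x; rewrite -(roots_on_rootsR p0) in_itv /= (perm_mem pst).
    by rewrite pE root_prod_XsubC.
by rewrite !size_sort.
Qed.

(** The multiple orthogonality splits into two ordinary ones: on each interval, the factor of [p]
    with zeros in the other interval keeps one sign and is moved into the weight. *)
Lemma angelesco_jacobi_state : exists ups xi : 'I_n -> R,
  [/\ ordered_in (- a) ups, ordered_in 1 xi,
      side_orthogonal (neg_integral alpha beta a) gamma ups xi,
      side_orthogonal (pos_integral alpha beta a) gamma xi ups &
      forall k : 'I_n,
        angelesco_jacobi_zero alpha beta gamma a n (n - k) = - ups k /\
        angelesco_jacobi_zero alpha beta gamma a n (n + k).+1 = xi k].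
Proof.
have [s [t [rst [ss st] [sa tb] [sn tn] pE]]] := angelesco_jacobi_roots.
pose ups (k : 'I_n) := - (rev s)`_k; pose xi (k : 'I_n) := t`_k.
have srs : size (rev s) = n by rewrite size_rev.
have s_in (k : 'I_n) : (rev s)`_k \in s.
  by rewrite -mem_rev mem_nth // srs.
have t_in (k : 'I_n) : t`_k \in t by rewrite mem_nth // tn.
have [sN sP] := moment_scalar halpha hbeta ha g0.
have prs : p = nodal (fun i : 'I_n => (rev s)`_i) * nodal xi.
  rewrite pE big_cat /=; congr (_ * _); last exact: prod_XsubC_seq.
  rewrite -(prod_XsubC_seq srs); apply: perm_big.
  by rewrite perm_sym perm_rev.
have nU : nodal (fun i : 'I_n => (rev s)`_i) = nodal (fun j => - ups j).
  by apply: eq_bigr => i _; rewrite opprK.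
exists ups, xi; split.
- split=> [i j ij|i].
    rewrite ltrN2; have so : sorted >%R (rev s) by rewrite rev_sorted.
    have gtr_trans : transitive (>%R : rel R) by move=> y x z /[swap]; exact: lt_trans.
    have := sorted_ltn_nth gtr_trans 0 so i j.
    by rewrite !inE srs; apply.
  have := sa _ (s_in i); rewrite in_itv/= => /andP[ai i0].
  by rewrite oppr_gt0 i0 ltrN2.
- split=> [i j ij|i].
    by apply: (sorted_ltn_nth lt_trans) => //; rewrite inE tn.
  by have := tb _ (t_in i); rewrite in_itv.
- move=> g sg.
  have On := @moment_orthogonal R _ n p sN (fun k kn => (angelesco_jacobi_moments kn).1).
  have := On (reflect_poly g); rewrite size_reflect => /(_ sg) <-.
  rewrite /neg_moment; congr (neg_integral _ _ _ _); apply/funext => u.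
  rewrite reflectM reflectK !hornerM.
  (* At x = -u both factors change sign, (-u + ups_i)(-u - xi_i) = (u - ups_i)(u + xi_i), so no
     global sign is left. *)
  have -> : (reflect_poly p).[u] = (nodal ups).[u] * (nodal (fun j => - xi j)).[u].
    rewrite horner_reflect prs nU hornerM !horner_nodal -!big_split /=.
    by apply: eq_bigr => i _; ring.
  by rewrite /side_weight; ring.
- move=> g sg.
  have Op := @moment_orthogonal R _ n p sP (fun k kn => (angelesco_jacobi_moments kn).2).
  rewrite -(Op g sg) /pos_moment; congr (pos_integral _ _ _ _); apply/funext => u.
  by rewrite prs nU !hornerM /side_weight; ring.
- move=> k; rewrite /angelesco_jacobi_zero -/p rst /=.
  have [h1 h2] := cat_nth_rev t k sn; rewrite h1 h2.
  by rewrite opprK.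
Qed.

End Zeros.

(** * From short steps in gamma to the whole half-line *)

Lemma locally_increasing (R : realType) (G : R) (f : R -> R) :
  (forall g h, G <= g -> g < h <= g + 1 -> f g < f h) ->
  forall g h, G <= g -> g < h -> f g < f h.
Proof.
move=> floc g h Gg gh.
have [N hN] : exists N : nat, h <= g + N%:R.
  exists (Num.truncn (h - g)).+1; rewrite -lerBlDl.
  exact/ltW/truncnS_gt.
elim: N h gh hN => [|N IH] h gh hN.
  by move: gh; rewrite ltNge -[leRHS]addr0 hN.
have [hgN|gNh] := leP h (g + N%:R); first exact: IH.
have [N0|N0] := posnP N.
  by apply: floc => //; rewrite gh; move: hN; rewrite N0.
have gN : g < g + N%:R by rewrite ltrDl ltr0n.
apply: (lt_trans (IH _ gN (lexx _))); apply: floc.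
  by apply: (le_trans Gg); exact: ltW.
by rewrite gNh -addrA natr1.
Qed.

Theorem theorem2p3 (R : realType) (alpha beta a : R) (n : nat)
    (halpha : -1 < alpha) (hbeta : -1 < beta) (ha : a < 0) (hn : (1 <= n)%N) :
  exists2 Gamma : R, -1 < Gamma &
    (forall j : nat, (1 <= j <= n)%N ->
      {in `]Gamma, +oo[ &, {homo
        (fun gamma => angelesco_jacobi_zero alpha beta gamma a n j)
          : g h /~ g < h}}) /\
    (forall j : nat, (n.+1 <= j <= 2 * n)%N ->
      {in `]Gamma, +oo[ &, {homo
        (fun gamma => angelesco_jacobi_zero alpha beta gamma a n j)
          : g h / g < h}}).
Proof.
have [G G2 HG] := coupled_zeros_increase n
  (neg_integral_positive alpha hbeta ha) (pos_integral_positive beta halpha ha).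
exists G; first by lra.
have loc (g h : R) (k : 'I_n) : G <= g -> g < h <= g + 1 ->
    angelesco_jacobi_zero alpha beta h a n (n - k) <
      angelesco_jacobi_zero alpha beta g a n (n - k) /\
    angelesco_jacobi_zero alpha beta g a n (n + k).+1 <
      angelesco_jacobi_zero alpha beta h a n (n + k).+1.
  move=> Gg gh; have g0 : 0 <= g by apply: (le_trans _ (le_trans G2 Gg)).
  have h0 : 0 <= h by case/andP: gh => /ltW gh _; exact: le_trans gh.
  have [u1 [x1 [ou1 ox1 so1 so1' z1]]] := angelesco_jacobi_state n halpha hbeta ha g0.
  have [u2 [x2 [ou2 ox2 so2 so2' z2]]] := angelesco_jacobi_state n halpha hbeta ha h0.
  have [z11 z12] := z1 k; have [z21 z22] := z2 k.
  rewrite z11 z12 z21 z22 ltrN2.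
  exact: (HG g h u1 u2 x1 x2).
split=> j /andP[j1 j2] g h; rewrite !in_itv/= !andbT => Gg Gh gh.
- have kn : (n - j < n)%N by lia.
  have jE : j = (n - Ordinal kn)%N by rewrite /= subKn.
  (* The moduli increase, so the chaining lemma is applied to the opposites of the negative
     zeros. *)
  rewrite -ltrN2 jE.
  apply: (@locally_increasing R G
    (fun gamma => - angelesco_jacobi_zero alpha beta gamma a n (n - Ordinal kn))) => //.
    by move=> g' h' Gg' gh'; rewrite ltrN2; case: (loc g' h' (Ordinal kn) Gg' gh').
  exact: ltW.
- have kn : (j - n.+1 < n)%N by lia.
  have jE : j = (n + Ordinal kn).+1 by rewrite /= -addSn subnKC.
  rewrite jE.
  apply: (@locally_increasing R G
    (fun gamma => angelesco_jacobi_zero alpha beta gamma a n (n + Ordinal kn).+1)) => //.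
    by move=> g' h' Gg' gh'; case: (loc g' h' (Ordinal kn) Gg' gh').
  exact: ltW.
Qed.
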